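(* Let $d\geq 1$ be an integer, let $m\geq 2$ be any integer, and let $M=\{M_\beta\}_{|\beta|\leq m}\subseteq\mathbb{C}$ be any family of complex numbers indexed by the multi-indices $\beta\in\mathbb{N}^d$ with $|\beta|\leq m$. Then $(\mathcal{M}_m^M,d_m)$ is a metric space (in particular, $d_m$ is finite on $\mathcal{M}_m^M\times\mathcal{M}_m^M$), and this metric space is not complete.
   Context: $\mathbb{N}=\{0,1,2,\dots\}$. For a multi-index $\beta=(\beta_1,\dots,\beta_d)\in\mathbb{N}^d$ and $x\in\mathbb{R}^d$, $|\beta|=\beta_1+\cdots+\beta_d$ and $x^\beta=x_1^{\beta_1}\cdots x_d^{\beta_d}$; for $x\in\mathbb{R}^d$, $|x|$ is the Euclidean norm. $\mathcal{M}=\mathcal{M}(\mathbb{R}^d)$ is the set of complex-valued finite Borel measures on $\mathbb{R}^d$. The Fourier transform of $\mu\in\mathcal{M}$ is $\widehat{\mu}(\xi)=\int_{\mathbb{R}^d}e^{-ix\cdot\xi}\,d\mu(x)$, $\xi\in\mathbb{R}^d$. For $\mu,\nu\in\mathcal{M}$, $$d_m(\mu,\nu)=\sup_{\xi\neq 0}\frac{|\widehat{\mu}(\xi)-\widehat{\nu}(\xi)|}{|\xi|^m}\in[0,\infty].$$ $\mathcal{M}_m$ is the set of $\mu\in\mathcal{M}$ with finite moments of order $m$, i.e. $\int_{\mathbb{R}^d}|x|^m\,d|\mu|(x)<\infty$, where $|\mu|$ is the total variation measure of $\mu$. Given $M=\{M_\beta\}_{|\beta|\leq m}\subseteq\mathbb{C}$,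 $$\mathcal{M}_m^M=\left\{\mu\in\mathcal{M}_m : \int_{\mathbb{R}^d}x^\beta\,d\mu(x)=M_\beta\text{ for all }\beta\in\mathbb{N}^d\text{ with }|\beta|\leq m\right\}.$$ *)

(* Defs.v *)
From HB Require Import structures.
From mathcomp Require Import all_boot all_order all_algebra.
From mathcomp Require Import all_classical all_reals all_analysis.
From mathcomp Require Import complex.

Set Implicit Arguments.
Unset Strict Implicit.
Unset Printing Implicit Defensive.
Import Order.TTheory GRing.Theory Num.Theory.
Import numFieldNormedType.Exports.
Local Open Scope classical_set_scope.
Local Open Scope complex_scope.
Local Open Scope ring_scope.

Notation borelRd R d := (g_sigma_algebraType (@open 'rV[R]_d)).

(* The norm `|x| of the library on 'rV[R]_d is the sup norm. *)
Definition dotprod (R : realType) (d : nat) (x y : 'rV[R]_d) : R :=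
  \sum_(i < d) x 0 i * y 0 i.

Definition enorm (R : realType) (d : nat) (x : 'rV[R]_d) : R :=
  Num.sqrt (dotprod x x).

Definition multi_index (d m : nat) : Type :=
  {beta : {ffun 'I_d -> nat} | (\sum_(i < d) beta i <= m)%N}.

Definition monomial (R : realType) (d m : nat) (beta : multi_index d m)
    (x : 'rV[R]_d) : R :=
  \prod_(i < d) x 0 i ^+ (val beta i).

(* A charge with values in \bar R[i] is finite and countably additive on
   measurable sets, i.e. it is a complex measure. Its values on non-measurable
   sets are unconstrained junk; they are normalized to 0 so that equality of
   records is equality of set functions on the sigma-algebra (cmeasureP). *)
Record cmeasure (dsp : measure_display) (T : measurableType dsp)
    (R : realType) : Type := CMeasure {
  cmeasure_charge :> {charge set T -> \bar R[i]} ;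
  cmeasure_junk : forall A : set T, ~ measurable A -> cmeasure_charge A = 0%E }.

Lemma cmeasureP (dsp : measure_display) (T : measurableType dsp) (R : realType)
    (mu nu : cmeasure T R) :
  mu = nu <-> forall A : set T, measurable A -> mu A = nu A.
Proof.
split=> [->//|]; case: mu nu => [mu mu0] [nu nu0] /= munu.
have E : (mu : set T -> \bar R[i]) = nu.
  apply/funext => A; case: (pselect (measurable A)) => [/munu//|nA].
  by rewrite mu0// nu0.
case: mu mu0 munu E => mu [[a] [b] [c]] mu0 munu /= E.
case: nu nu0 munu E => nu [[a'] [b'] [c']] nu0 munu /= E.
move: E a b c mu0 a' b' c' nu0 munu => -> a b c mu0 a' b' c' nu0 _.
by rewrite (Prop_irrelevance a a') (Prop_irrelevance b b')
  (Prop_irrelevance c c') in mu0 *; rewrite (Prop_irrelevance mu0 nu0).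
Qed.

Lemma charge_part_sigma_additive (dsp : measure_display)
    (T : measurableType dsp) (R : realType) (p : {additive R[i] -> R})
    (ple : forall z, `|p z|%:C <= `|z|) (mu : {charge set T -> \bar R[i]}) :
  semi_sigma_additive (fun A : set T => (p (fine (mu A)))%:E).
Proof.
move=> F mF tF mU.
have fmu A : measurable A -> mu A \is a fin_num by exact: fin_num_measure.
have fS n : (\sum_(0 <= i < n) mu (F i))%E
    = (\sum_(0 <= i < n) fine (mu (F i)))%:E.
  by rewrite -sumEFin; apply: eq_bigr => i _; rewrite fineK// fmu.
have := @charge_semi_sigma_additive _ _ _ mu F mF tF mU.
rewrite -[X in _ --> X](fineK (fmu _ mU)) => muc.
set z := fine _ in muc *.
have -> : (fun n => \sum_(0 <= i < n) (p (fine (mu (F i))))%:E)%E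
    = EFin \o (fun n => p (\sum_(0 <= i < n) fine (mu (F i)))).
  by apply/funext => n /=; rewrite raddf_sum sumEFin.
suff pc : (fun n => p (\sum_(0 <= i < n) fine (mu (F i)))) @ \oo --> p z.
  by move=> A Apz; exact: (pc (EFin @^-1` A) Apz).
apply/cvgrPdist_lt => e e0.
have eC : 0 < e%:C by rewrite -[0]/(0%:C) ltcR.
have /muc : nbhs (z%:E : \bar R[i]) [set w | `|z - fine w| < e%:C].
  by apply/nbhs_ballP; exists e%:C.
rewrite /nbhs /=; apply: filterS => n /=.
rewrite fS /= => Sn.
by rewrite -raddfB -ltcR; apply: le_lt_trans (ple _) Sn.
Qed.

Definition cm_re (dsp : measure_display) (T : measurableType dsp)
    (R : realType) (mu : {charge set T -> \bar R[i]}) : set T -> \bar R :=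
  fun A => (complex.Re (fine (mu A)))%:E.

Definition cm_im (dsp : measure_display) (T : measurableType dsp)
    (R : realType) (mu : {charge set T -> \bar R[i]}) : set T -> \bar R :=
  fun A => (complex.Im (fine (mu A)))%:E.

Section cm_parts.
Context (dsp : measure_display) (T : measurableType dsp) (R : realType).
Variable mu : {charge set T -> \bar R[i]}.

Let re0 : cm_re mu set0 = 0%E.
Proof. by rewrite /cm_re charge0. Qed.

Let re_fin A : measurable A -> cm_re mu A \is a fin_num.
Proof. by []. Qed.

Let re_sigma : semi_sigma_additive (cm_re mu).
Proof. by apply: charge_part_sigma_additive => z; exact: normc_ge_Re. Qed.

HB.instance Definition _ :=
  isCharge.Build dsp T R (cm_re mu) re0 re_fin re_sigma.

Let im0 : cm_im mu set0 = 0%E.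
Proof. by rewrite /cm_im charge0. Qed.

Let im_fin A : measurable A -> cm_im mu A \is a fin_num.
Proof. by []. Qed.

Let im_sigma : semi_sigma_additive (cm_im mu).
Proof.
apply: charge_part_sigma_additive => z; rewrite normc_def lecR.
by rewrite -sqrtr_sqr ler_sqrt ?addr_ge0 ?sqr_ge0// lerDr sqr_ge0.
Qed.

HB.instance Definition _ :=
  isCharge.Build dsp T R (cm_im mu) im0 im_fin im_sigma.

End cm_parts.

Definition hahn (dsp : measure_display) (T : measurableType dsp)
    (R : realType) (nu : {charge set T -> \bar R}) :
    {PN : set T * set T | hahn_decomposition nu PN.1 PN.2} :=
  let: exist P exP := cid (Hahn_decomposition nu) in
  let: exist N PN := cid exP in exist _ (P, N) PN.

(* Integral against a signed charge through its Jordan decomposition. *)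
Definition charge_integral (dsp : measure_display) (T : measurableType dsp)
    (R : realType) (nu : {charge set T -> \bar R}) (f : T -> R) : R :=
  (\int[jordan_pos (svalP (hahn nu))]_x f x
   - \int[jordan_neg (svalP (hahn nu))]_x f x)%R.

(* (f1 + i f2) (dmu1 + i dmu2) expanded into four real integrals; it is meant
   for integrands that are integrable for the total variation of mu. *)
Definition cintegral (dsp : measure_display) (T : measurableType dsp)
    (R : realType) (mu : cmeasure T R) (f : T -> R[i]) : R[i] :=
  (charge_integral (cm_re mu) (fun x => complex.Re (f x))
    - charge_integral (cm_im mu) (fun x => complex.Im (f x)))
  +i* (charge_integral (cm_re mu) (fun x => complex.Im (f x))
    + charge_integral (cm_im mu) (fun x => complex.Re (f x))).

Definition total_variation (dsp : measure_display) (T : measurableType dsp)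
    (R : realType) (mu : cmeasure T R) (A : set T) : \bar R :=
  ereal_sup [set (\sum_(k <oo) (Normc.normc (fine (mu (F k))))%:E)%E |
    F in [set F : (set T)^nat | (forall k, measurable (F k)) /\
                                trivIset setT F /\ \bigcup_k F k = A]].

Definition fourier (R : realType) (d : nat) (mu : cmeasure (borelRd R d) R)
    (xi : 'rV[R]_d) : R[i] :=
  cintegral mu
    (fun x : 'rV[R]_d => cos (dotprod x xi) -i* sin (dotprod x xi)).

Definition dm (R : realType) (d m : nat) (mu nu : cmeasure (borelRd R d) R) :
    \bar R :=
  ereal_sup [set (Normc.normc (fourier mu xi - fourier nu xi) / enorm xi ^+ m)%:E |
    xi in [set xi : 'rV[R]_d | xi != 0]].

Definition finite_moment (R : realType) (d m : nat)
    (mu : cmeasure (borelRd R d) R) : Prop :=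
  (\int[total_variation mu]_x ((enorm (x : 'rV[R]_d)) ^+ m)%:E < +oo)%E.

Definition moment_class (R : realType) (d m : nat)
    (M : multi_index d m -> R[i]) : set (cmeasure (borelRd R d) R) :=
  [set mu | finite_moment m mu /\
    forall beta : multi_index d m,
      cintegral mu (fun x : 'rV[R]_d => (monomial beta x)%:C) = M beta].

(* Limits are taken inside X and [cauchy] refers to the uniformity of X, which
   the metricType structure ties to the distance mdist. *)
Definition complete_metric (R : realType) (X : metricType R) : Prop :=
  forall u : nat -> X, cauchy (u @ \oo) -> exists l : X, u @ \oo --> l.

(* Main.v *)
Require Import Defs.
From HB Require Import structures.
From mathcomp Require Import all_boot all_order all_algebra.
From mathcomp Require Import all_classical all_reals all_analysis.
From mathcomp Require Import complex measurable_realfun ring lra.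

Set Implicit Arguments.
Unset Strict Implicit.
Unset Printing Implicit Defensive.
Import Order.TTheory GRing.Theory Num.Theory.
Import numFieldNormedType.Exports.
Local Open Scope classical_set_scope.
Local Open Scope complex_scope.
Local Open Scope ring_scope.

(* Linear combinations and bounded pointwise limits of the functions
   x |-> cos (x . xi + c) form an algebra which contains the sign of each
   coordinate, hence the indicator of every Borel set: the Fourier transform
   determines the measure.  When the moments up to order m agree, the Taylor
   polynomials of degree < m of the exponentials cancel and d_m is finite.
   The class contains a finite combination mu0 of Dirac masses, by interpolation
   on a grid.

   Let tau be a nonzero combination of Dirac masses on a line whose moments up
   to order m vanish, so that its transform is O(min(1, |s|^(m+1))), and add to
   mu0 the blocks (j+1)^-1 K^(-jm) tau(K^-j .) for j < n.  Because the scales K^j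
   are lacunary, sum_j min(K^j s, 1 / (K^j s)) is bounded, so the n-th sum is at
   distance O(1/(J+1)) from the J-th one for n >= J.  A limit would have the same
   transform as the infinite sum, whose moment of order m dominates the harmonic
   series. *)

(** The factor [K^(-jm)] makes the absolute moment of order m of a block invariant under the
    dilation by [K^j], and likewise its size in d_m, which weighs frequencies by |xi|^-m. So the
    weights 1/(j+1) decide: the absolute moments add up to a harmonic series, whereas in d_m the
    blocks live at separate frequencies and only the largest weight counts. For this each block must
    be small away from its own frequency: boundedness of the transform gives decay above it, and the
    vanishing of the moments of order m itself, not only of lower order, gives decay below it.

    Since these moments vanish, no monomial of degree at most m detects the divergence. The test
    functions [spikes] pick one atom per block instead; they are discontinuous, but they lie in the
    trigonometric closure, so that equality of transforms reaches them. The infinite sum is never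
    built as a measure: only the limits of its partial pairings with closure functions occur. *)

Section complex_modulus.
Context (R : realType).
Implicit Types z w : R[i].

Lemma normc_ge0 z : 0 <= Normc.normc z.
Proof. by case: z => a b; exact: sqrtr_ge0. Qed.

Lemma normc_le_ReIm z : Normc.normc z <= `|complex.Re z| + `|complex.Im z|.
Proof.
case: z => a b /=; rewrite -[leRHS]ger0_norm ?addr_ge0// -sqrtr_sqr ler_sqrt ?sqr_ge0//.
by rewrite sqrrD !real_normK ?num_real// addrAC lerDl mulrn_wge0// mulr_ge0.
Qed.

Lemma Re_le_normc z : `|complex.Re z| <= Normc.normc z.
Proof.
by case: z => a b /=; rewrite -sqrtr_sqr ler_sqrt ?addr_ge0 ?sqr_ge0// lerDl sqr_ge0.
Qed.

Lemma Im_le_normc z : `|complex.Im z| <= Normc.normc z.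
Proof.
by case: z => a b /=; rewrite -sqrtr_sqr ler_sqrt ?addr_ge0 ?sqr_ge0// lerDr sqr_ge0.
Qed.

Lemma ReB z w : complex.Re (z - w) = complex.Re z - complex.Re w.
Proof. by case: z w => [a b] [c d]. Qed.

Lemma ImB z w : complex.Im (z - w) = complex.Im z - complex.Im w.
Proof. by case: z w => [a b] [c d]. Qed.

End complex_modulus.

(** * Charges, Jordan parts and the total variation *)

Section integral_and_measure.
Context (dsp : measure_display) (T : measurableType dsp) (R : realType).
Implicit Types (P Q : {measure set T -> \bar R}) (f : T -> R).

Lemma le_measure_integrable P Q f :
  (forall A, measurable A -> (P A <= Q A)%E) ->
  Q.-integrable setT (EFin \o f) -> P.-integrable setT (EFin \o f).
Proof.
move=> PQ /integrableP[mf Qf]; apply/integrableP; split => //.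
apply: le_lt_trans Qf; apply: ge0_le_measure_integral => //.
exact: measurableT_comp.
Qed.

Lemma integrable_measure_add P Q f :
  P.-integrable setT (EFin \o f) -> Q.-integrable setT (EFin \o f) ->
  (measure_add P Q).-integrable setT (EFin \o f).
Proof.
move=> /integrableP[mf Pf] /integrableP[_ Qf]; apply/integrableP; split => //.
rewrite ge0_integral_measure_add//; last exact: measurableT_comp.
exact: lte_add_pinfty.
Qed.

Lemma Rintegral_measure_add P Q f :
  P.-integrable setT (EFin \o f) -> Q.-integrable setT (EFin \o f) ->
  \int[measure_add P Q]_x f x = \int[P]_x f x + \int[Q]_x f x.
Proof.
move=> iP iQ; have [mf _] := integrableP _ _ _ iP.
rewrite /Rintegral integral_measure_add//.
by rewrite fineD//; exact: integrable_fin_num.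
Qed.

Lemma Rintegral_eq_measure P Q f :
  (forall A, measurable A -> P A = Q A) ->
  \int[P]_x f x = \int[Q]_x f x.
Proof. by move=> PQ; congr fine; apply: eq_measure_integral => A mA _; apply: PQ. Qed.

Lemma bounded_integrable (P : {finite_measure set T -> \bar R}) f (c : R) :
  measurable_fun setT f -> (forall x, `|f x| <= c) ->
  P.-integrable setT (EFin \o f).
Proof.
move=> mf fc; apply: (@le_integrable _ _ _ _ _ measurableT _ (cst c%:E)).
- exact/measurable_EFinP.
- move=> x _ /=; rewrite lee_fin (le_trans (fc x))// ler_norm//.
- exact: finite_measure_integrable_cst.
Qed.

End integral_and_measure.

Lemma sube_cross (R : realDomainType) (a b p n : \bar R) :
  a \is a fin_num -> b \is a fin_num -> p \is a fin_num -> n \is a fin_num ->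
  (a - b = p - n -> p + b = n + a)%E.
Proof.
move=> /fineK <- /fineK <- /fineK <- /fineK <-.
rewrite -!EFinB -!EFinD => -[/eqP]; rewrite subr_eq => /eqP ->.
by congr (_%:E); ring.
Qed.

Section jordan_parts.
Context (dsp : measure_display) (T : measurableType dsp) (R : realType).
Implicit Types (nu : {charge set T -> \bar R}) (f : T -> R).

Definition hpos nu : {finite_measure set T -> \bar R} :=
  jordan_pos (svalP (hahn nu)).
Definition hneg nu : {finite_measure set T -> \bar R} :=
  jordan_neg (svalP (hahn nu)).

Lemma hahn_parts nu (A : set T) : measurable A -> nu A = (hpos nu A - hneg nu A)%E.
Proof.
move=> mA; rewrite (jordan_decomp (svalP (hahn nu)) mA) /cadd/=.
by rewrite cscaleN1.
Qed.

Lemma hposE nu (A : set T) : measurable A ->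
  hpos nu A = nu (A `&` (sval (hahn nu)).1).
Proof. by move=> mA; rewrite /hpos /= jordan_posE cjordan_posE /crestr0 mem_set. Qed.

Lemma hnegE nu (A : set T) : measurable A ->
  hneg nu A = (- nu (A `&` (sval (hahn nu)).2))%E.
Proof. by move=> mA; rewrite /hneg /= jordan_negE cjordan_negE /crestr0 mem_set. Qed.

Lemma hahn_setP nu :
  [/\ measurable (sval (hahn nu)).1, measurable (sval (hahn nu)).2,
   (sval (hahn nu)).1 `|` (sval (hahn nu)).2 = setT &
   (sval (hahn nu)).1 `&` (sval (hahn nu)).2 = set0].
Proof. by have [[mP _] [mN _] PNT PN0] := svalP (hahn nu); split => //; rewrite -inE. Qed.

(** Any two finite measures qualify, not only mutually singular ones; this freedom later allows a
    Dirac mass to be added to either part. *)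
Definition charge_split nu (P N : {finite_measure set T -> \bar R}) :=
  forall A, measurable A -> nu A = (P A - N A)%E.

(** Minimality of the Jordan decomposition: on the positive Hahn set [nu] is at most [P]. It
    transfers integrability from an arbitrary splitting to the Hahn part. *)
Lemma hpos_le nu (P N : {finite_measure set T -> \bar R}) :
  charge_split nu P N ->
  forall A, measurable A -> (hpos nu A <= P A)%E.
Proof.
move=> nuPN A mA; have [mP _ _ _] := hahn_setP nu.
rewrite hposE// nuPN; last exact: measurableI.
apply: (@le_trans _ _ (P (A `&` (sval (hahn nu)).1))).
  by rewrite leeBlDr ?fin_num_measure//; [exact: leeDl|exact: measurableI].
exact: measureIl.
Qed.

Lemma hneg_le nu (P N : {finite_measure set T -> \bar R}) :
  charge_split nu P N ->
  forall A, measurable A -> (hneg nu A <= N A)%E.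
Proof.
move=> nuPN A mA; have [_ mN _ _] := hahn_setP nu.
have mAN := measurableI _ _ mA mN.
rewrite hnegE// nuPN; last exact: measurableI.
rewrite fin_num_oppeB ?fin_num_measure// addeC.
apply: (@le_trans _ _ (N (A `&` (sval (hahn nu)).2))).
  by rewrite leeBlDr ?fin_num_measure//; exact: leeDl.
exact: measureIl.
Qed.

(** Moving the subtracted measures to the other side leaves sums of positive measures, for which the
    integral is additive in the measure. *)
Lemma hahn_cross nu (P N : {finite_measure set T -> \bar R}) :
  charge_split nu P N -> forall A, measurable A ->
  measure_add (hpos nu) N A = measure_add (hneg nu) P A.
Proof.
move=> nuPN A mA; rewrite !measure_addE.
apply: sube_cross; rewrite ?fin_num_measure//.
by rewrite -hahn_parts// nuPN.
Qed.

(** Independence of the splitting: explicit measures can replace the parts given by the Hahn sets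
    that [hahn] chooses. *)
Lemma charge_integralE nu (P N : {finite_measure set T -> \bar R}) f :
  charge_split nu P N ->
  P.-integrable setT (EFin \o f) -> N.-integrable setT (EFin \o f) ->
  charge_integral nu f = \int[P]_x f x - \int[N]_x f x.
Proof.
move=> nuPN iP iN.
have ip := le_measure_integrable (hpos_le nuPN) iP.
have iq := le_measure_integrable (hneg_le nuPN) iN.
have := Rintegral_eq_measure f (hahn_cross nuPN).
rewrite !Rintegral_measure_add// /charge_integral -/(hpos nu) -/(hneg nu) => E.
by apply/eqP; rewrite subr_eq addrAC eq_sym subr_eq addrC [in X in _ == X]E addrC.
Qed.

End jordan_parts.

Section set_function_integral.
Context (dsp : measure_display) (T : measurableType dsp) (R : realType).
Import HBNNSimple.

(** [sintegral] sums over all real values; those outside the range have empty preimage, where [m]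
    vanishes. The remaining sum asks for no measure structure on [m]. *)
Lemma sintegral_set_functionE (m : set T -> \bar R) (h : T -> R) : m set0 = 0%E ->
  sintegral m h = (\sum_(x \in range h) x%:E * m (h @^-1` [set x]))%E.
Proof.
move=> m0; rewrite /sintegral (fsbig_widen (range h) setT)//= => x [_ Nhx] /=.
by rewrite preimage10// m0 mule0.
Qed.

(* [total_variation mu] is a bare set function, hence the lack of measure
   structures on [m1] and [m2]. *)
Lemma le_set_function_integral (m1 m2 : set T -> \bar R) (f : T -> \bar R) :
  m1 set0 = 0%E -> m2 set0 = 0%E ->
  (forall A, measurable A -> 0 <= m1 A <= m2 A)%E ->
  (forall x, 0 <= f x)%E -> (\int[m1]_x f x <= \int[m2]_x f x)%E.
Proof.
move=> m10 m20 m12 f0; rewrite /integral !patch_setT.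
have -> : (f^\+)%E = f by apply/funext => x; rewrite (@ge0_funeposE _ _ setT)// inE.
have -> : (f^\-)%E = cst 0%E.
  by apply/funext => x; rewrite (@ge0_funenegE _ _ setT)// inE.
have neg0 (m : set T -> \bar R) : m set0 = 0%E ->
    ereal_sup [set sintegral m h |
      h in [set h : {nnsfun T >-> R} | forall x, ((h x)%:E <= cst 0 x)%E]] = 0%E.
  move=> m0; have s0 (h : {nnsfun T >-> R}) :
      (forall x, ((h x)%:E <= cst 0 x)%E) -> sintegral m h = 0%E.
    move=> h0; rewrite sintegral_set_functionE// fsbig1// => _ [x _ <-].
    have -> : h x = 0 by apply/eqP; rewrite eq_le -lee_fin h0/=.
    by rewrite mul0e.
  apply/eqP; rewrite eq_le; apply/andP; split.
    by apply: ge_ereal_sup => _ [h /= /s0 + <-] => ->.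
  by apply: ereal_sup_ubound; exists (@nnsfun0 _ T R) => //; exact: s0.
rewrite !neg0// !sube0; apply: ge_ereal_sup => _ [h /= hf <-].
apply: (@le_trans _ _ (sintegral m2 h)); last first.
  by apply: ereal_sup_ubound; exists h.
rewrite !sintegral_set_functionE//; apply: lee_fsum => // _ [x _ <-].
have mh : measurable (h @^-1` [set h x]) by exact: measurable_sfunP.
by have /andP[? ?] := m12 _ mh; rewrite lee_pmul// lee_fin.
Qed.

End set_function_integral.

Section tvar.
Context (dsp : measure_display) (T : measurableType dsp) (R : realType).
Variable mu : cmeasure T R.

(** The two Hahn pieces of [A], followed by empty sets, form an admissible partition for the
    supremum. The charge [nu] will be the real or the imaginary part of [mu]. *)
Lemma tvar_ge (nu : {charge set T -> \bar R}) (A : set T) :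
  (forall B, measurable B -> `|nu B| <= (Normc.normc (fine (mu B)))%:E)%E ->
  measurable A -> (hpos nu A + hneg nu A <= Defs.total_variation mu A)%E.
Proof.
move=> numu mA; have [mP mN PNT PN0] := hahn_setP nu.
set P := (sval (hahn nu)).1 in mP PNT PN0 *.
set N := (sval (hahn nu)).2 in mN PNT PN0 *.
have mAP := measurableI _ _ mA mP; have mAN := measurableI _ _ mA mN.
pose F := bigcup2 (A `&` P) (A `&` N).
have mF k : measurable (F k) by case: k => [|[|k]]; rewrite /F/=.
apply: (@le_trans _ _ (\sum_(k <oo) (Normc.normc (fine (mu (F k))))%:E)%E); last first.
  apply: ereal_sup_ubound; exists F => //; split => //; split.
    by rewrite -trivIset_bigcup2 setIACA PN0 setI0.
  by rewrite /F bigcup2E -setIUr PNT setIT.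
apply: le_trans (nneseries_lim_ge 2 _); last first.
  by move=> k _ _; rewrite lee_fin normc_ge0.
rewrite big_nat_recl// big_nat1; apply: leeD.
  rewrite hposE//; apply: le_trans (numu _ mAP); exact: lee_abs.
by rewrite hnegE//; apply: le_trans (numu _ mAN); rewrite -abseN lee_abs.
Qed.

(** Along any partition the bounds on the pieces add up to [P A] by countable additivity of [P]. *)
Lemma tvar_le (P : {measure set T -> \bar R}) (A : set T) :
  (forall B, measurable B -> (Normc.normc (fine (mu B)))%:E <= P B)%E ->
  measurable A -> (Defs.total_variation mu A <= P A)%E.
Proof.
move=> muP mA; apply: ge_ereal_sup => _ [F [mF [tF UF]] <-].
have := @measure_semi_sigma_additive _ _ _ P F mF tF.
rewrite UF => /(_ mA)/cvg_lim <- //.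
by apply: lee_nneseries => k _; [rewrite lee_fin normc_ge0|exact: muP].
Qed.

Lemma tvar_ge0 (A : set T) : measurable A ->
  (0 <= Defs.total_variation mu A)%E.
Proof.
move=> mA; apply: (@le_trans _ _ (\sum_(k <oo)
   (Normc.normc (fine (mu (bigcup2 A set0 k))))%:E)%E).
  by apply: nneseries_ge0 => k _ _; rewrite lee_fin normc_ge0.
apply: ereal_sup_ubound; exists (bigcup2 A set0) => //; split.
  by move=> [|[|k]] /=.
split; last by rewrite bigcup2E setU0.
by rewrite -trivIset_bigcup2 setI0.
Qed.

End tvar.

Section complex_of_charges.
Context (dsp : measure_display) (T : measurableType dsp) (R : realType).
Variables a b : {charge set T -> \bar R}.

(** The value 0 off the sigma-algebra is the normalization that [cmeasure] requires. *)
Definition charge_complex (A : set T) : \bar R[i] :=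
  if A \in measurable then (fine (a A) +i* fine (b A))%:E else 0%E.

Let charge_complex_fin : fin_num_fun charge_complex.
Proof. by move=> A mA; rewrite /charge_complex mem_set. Qed.

HB.instance Definition _ := isFinite.Build _ _ _ charge_complex charge_complex_fin.

Let sum_charge_complex (F : nat -> set T) n : (forall k, measurable (F k)) ->
  (\sum_(i < n) charge_complex (F i))%E =
  ((\sum_(i < n) fine (a (F i))) +i* (\sum_(i < n) fine (b (F i))))%:E.
Proof.
move=> mF; elim: n => [|n IH]; first by rewrite !big_ord0.
by rewrite !big_ord_recr/= IH /charge_complex mem_set.
Qed.

Let sum_fine (c : {charge set T -> \bar R}) (F : nat -> set T) n :
  (forall k, measurable (F k)) ->
  (\sum_(i < n) c (F i))%E = (\sum_(i < n) fine (c (F i)))%:E.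
Proof. by move=> mF; rewrite -sumEFin; apply: eq_bigr => i _; rewrite fineK// fin_num_measure. Qed.

Let charge_complex_additive : measure_function.semi_additive charge_complex.
Proof.
move=> F n mF tF mU; rewrite sum_charge_complex// /charge_complex mem_set//.
by rewrite !charge_semi_additive// !sum_fine.
Qed.

HB.instance Definition _ :=
  isAdditiveCharge.Build _ _ _ charge_complex charge_complex_additive.

Let charge_complex_sigma_additive : semi_sigma_additive charge_complex.
Proof.
move=> F mF tF mU.
have cvg_fine (c : {charge set T -> \bar R}) :
    \sum_(i < n) fine (c (F i)) @[n --> \oo] --> fine (c (\bigcup_k F k)).
  have := @charge_semi_sigma_additive _ _ _ c F mF tF mU.
  rewrite -[X in _ --> X](fineK (fin_num_measure c _ mU)) => /fine_cvgP[_].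
  apply: cvg_trans; apply: near_eq_cvg; near=> n => /=.
  by rewrite big_mkord sum_fine.
rewrite [X in X @ _ --> _](_ : _ = EFin \o (fun n =>
    (\sum_(i < n) fine (a (F i))) +i* (\sum_(i < n) fine (b (F i))))); last first.
  by apply/funext => n; rewrite big_mkord sum_charge_complex.
rewrite /charge_complex mem_set//.
set u := fun n => _; set z := _ +i* _.
suff uz : (u : nat -> (R[i] : numFieldType)) n @[n --> \oo] --> (z : (R[i] : numFieldType)).
  by move=> A Az; exact: (uz (EFin @^-1` A) Az).
(* Positivity in the partial order of [R[i]] forces a zero imaginary part, so the tolerance is a
   real [e]. *)
apply/cvgrPdist_lt => -[e e'] /[dup]; rewrite ltcE/= => /andP[/eqP-> e0] _.
have e20 : 0 < e / 2 by rewrite divr_gt0.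
near=> n; rewrite normc_def; apply: (@le_lt_trans _ _ (Normc.normc (z - u n))%:C).
  by rewrite /Normc.normc; case: (z - u n).
rewrite ltcR; apply: le_lt_trans (normc_le_ReIm _) _.
rewrite [ltRHS]splitr ltrD//=.
- by near: n; have /cvgrPdist_lt/(_ _ e20) := cvg_fine a.
- by near: n; have /cvgrPdist_lt/(_ _ e20) := cvg_fine b.
Unshelve. all: by end_near. Qed.

HB.instance Definition _ :=
  isSemiSigmaAdditive.Build _ _ _ charge_complex charge_complex_sigma_additive.

Definition cmeasure_of_charges : cmeasure T R.
Proof.
exists charge_complex => A nA.
by rewrite /= /charge_complex; case: ifPn => //; rewrite inE.
Defined.

Lemma cm_re_of_charges A : measurable A -> cm_re cmeasure_of_charges A = a A.
Proof.
by move=> mA; rewrite /cm_re/= /charge_complex mem_set//= fineK// fin_num_measure.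
Qed.

Lemma cm_im_of_charges A : measurable A -> cm_im cmeasure_of_charges A = b A.
Proof.
by move=> mA; rewrite /cm_im/= /charge_complex mem_set//= fineK// fin_num_measure.
Qed.

End complex_of_charges.

Section splitting.
Context (dsp : measure_display) (T : measurableType dsp) (R : realType).
Implicit Types (mu : cmeasure T R) (P N : {finite_measure set T -> \bar R}).

Definition cm_split mu P1 N1 P2 N2 :=
  charge_split (cm_re mu) P1 N1 /\ charge_split (cm_im mu) P2 N2.

Lemma cm_split_hahn mu :
  cm_split mu (hpos (cm_re mu)) (hneg (cm_re mu)) (hpos (cm_im mu)) (hneg (cm_im mu)).
Proof. by split; exact: hahn_parts. Qed.

Lemma cm_split_eq mu nu P1 N1 P2 N2 :
  cm_split mu P1 N1 P2 N2 -> cm_split nu P1 N1 P2 N2 -> mu = nu.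
Proof.
move=> [mu1 mu2] [nu1 nu2]; apply/cmeasureP => A mA.
have := mu1 A mA; rewrite -nu1// => -[re].
have := mu2 A mA; rewrite -nu2// => -[im].
rewrite -(fineK (fin_num_measure mu _ mA)) -(fineK (fin_num_measure nu _ mA)).
by move: re im; case: (fine (mu A)) => a b; case: (fine (nu A)) => a' b' /= -> ->.
Qed.

Definition cmeasure_of P1 N1 P2 N2 : cmeasure T R := cmeasure_of_charges
  (cadd (charge_of_finite_measure P1) (copp (charge_of_finite_measure N1)))
  (cadd (charge_of_finite_measure P2) (copp (charge_of_finite_measure N2))).

Lemma cm_split_of P1 N1 P2 N2 : cm_split (cmeasure_of P1 N1 P2 N2) P1 N1 P2 N2.
Proof.
by split=> A mA; [exact: cm_re_of_charges|exact: cm_im_of_charges].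
Qed.

Definition all4 (p : {finite_measure set T -> \bar R} -> Prop) P1 N1 P2 N2 :=
  [/\ p P1, p N1, p P2 & p N2].

Lemma normc_le_ereal (z : R[i]) (a b c e : \bar R) :
  a \is a fin_num -> b \is a fin_num -> c \is a fin_num -> e \is a fin_num ->
  (0 <= a)%E -> (0 <= b)%E -> (0 <= c)%E -> (0 <= e)%E ->
  ((complex.Re z)%:E = a - b)%E -> ((complex.Im z)%:E = c - e)%E ->
  ((Normc.normc z)%:E <= a + b + (c + e))%E.
Proof.
move=> /fineK <- /fineK <- /fineK <- /fineK <-; rewrite !lee_fin => a0 b0 c0 e0.
rewrite -!EFinB => -[re] [im].
apply: le_trans (normc_le_ReIm _) _; rewrite re im.
by apply: lerD; apply: le_trans (ler_normB _ _) _; rewrite !ger0_norm.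
Qed.

Lemma normc_le_split mu P1 N1 P2 N2 B :
  cm_split mu P1 N1 P2 N2 -> measurable B ->
  ((Normc.normc (fine (mu B)))%:E <=
     measure_add (measure_add P1 N1) (measure_add P2 N2) B)%E.
Proof.
move=> [s1 s2] mB.
have -> : measure_add (measure_add P1 N1) (measure_add P2 N2) B =
    (P1 B + N1 B + (P2 B + N2 B))%E.
  by rewrite measure_addE; congr (_ + _)%E; exact: measure_addE.
by apply: normc_le_ereal; rewrite ?fin_num_measure//; [exact: s1|exact: s2].
Qed.

Lemma tvar0 mu : Defs.total_variation mu set0 = 0%E.
Proof.
apply/eqP; rewrite eq_le; apply/andP; split; last exact: tvar_ge0.
set P := measure_add (measure_add (hpos (cm_re mu)) (hneg (cm_re mu)))
  (measure_add (hpos (cm_im mu)) (hneg (cm_im mu))).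
rewrite -[leRHS](measure0 P); apply: tvar_le => // B mB.
exact: normc_le_split (cm_split_hahn mu) mB.
Qed.

Lemma le_tvar_integral mu (nu : {charge set T -> \bar R}) (f : T -> \bar R) :
  (forall B, measurable B -> `|nu B| <= (Normc.normc (fine (mu B)))%:E)%E ->
  (forall x, 0 <= f x)%E ->
  (\int[hpos nu]_x f x <= \int[Defs.total_variation mu]_x f x)%E /\
  (\int[hneg nu]_x f x <= \int[Defs.total_variation mu]_x f x)%E.
Proof.
move=> numu f0; split; apply: le_set_function_integral; rewrite ?measure0 ?tvar0//.
  move=> A mA; rewrite measure_ge0/=; apply: le_trans (tvar_ge numu mA).
  by rewrite leeDl.
move=> A mA; rewrite measure_ge0/=; apply: le_trans (tvar_ge numu mA).
by rewrite leeDr.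
Qed.

Lemma tvar_integral_hahn mu (f : T -> \bar R) :
  (forall x, 0 <= f x)%E -> (\int[Defs.total_variation mu]_x f x < +oo)%E ->
  all4 (fun P => \int[P]_x f x < +oo)%E
    (hpos (cm_re mu)) (hneg (cm_re mu)) (hpos (cm_im mu)) (hneg (cm_im mu)).
Proof.
move=> f0 mf.
have [] := @le_tvar_integral mu (cm_re mu) f _ f0.
  by move=> B mB; rewrite /cm_re/= lee_fin Re_le_normc.
have [] := @le_tvar_integral mu (cm_im mu) f _ f0.
  by move=> B mB; rewrite /cm_im/= lee_fin Im_le_normc.
by split; apply: le_lt_trans mf.
Qed.

Lemma tvar_integral_lty mu P1 N1 P2 N2 (f : T -> \bar R) :
  cm_split mu P1 N1 P2 N2 -> (forall x, 0 <= f x)%E -> measurable_fun setT f ->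
  all4 (fun P => \int[P]_x f x < +oo)%E P1 N1 P2 N2 ->
  (\int[Defs.total_variation mu]_x f x < +oo)%E.
Proof.
move=> smu f0 mf [i1 i2 i3 i4].
(* The total variation is dominated by the sum of the four parts, a genuine measure whose integral
   splits. *)
apply: (@le_lt_trans _ _ (\int[measure_add (measure_add P1 N1) (measure_add P2 N2)]_x f x)%E).
  apply: le_set_function_integral => //; rewrite ?measure0 ?tvar0//.
  move=> A mA; rewrite tvar_ge0//=.
  apply: (@tvar_le _ _ _ mu (measure_add _ _)) => // B mB.
  exact: normc_le_split.
rewrite ge0_integral_measure_add//; apply: lte_add_pinfty.
  by rewrite ge0_integral_measure_add//; exact: lte_add_pinfty.
by rewrite ge0_integral_measure_add//; exact: lte_add_pinfty.
Qed.

End splitting.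

(** * Dot product, Euclidean norm and Borel functions *)

Section dotprod.
Context (R : realType) (d : nat).
Implicit Types x y z : 'rV[R]_d.

Lemma dotprodDr x y z : dotprod x (y + z) = dotprod x y + dotprod x z.
Proof. by rewrite -big_split; apply: eq_bigr => i _; rewrite mxE mulrDr. Qed.

Lemma dotprodNr x y : dotprod x (- y) = - dotprod x y.
Proof. by rewrite /dotprod -sumrN; apply: eq_bigr => i _; rewrite mxE mulrN. Qed.

Lemma dotprodZr a x y : dotprod x (a *: y) = a * dotprod x y.
Proof. by rewrite /dotprod mulr_sumr; apply: eq_bigr => i _; rewrite mxE mulrCA. Qed.

Lemma dotprod0r x : dotprod x 0 = 0.
Proof. by rewrite /dotprod big1// => i _; rewrite mxE mulr0. Qed.

Lemma dotprod_delta x i : dotprod x (delta_mx 0 i) = x 0 i.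
Proof.
rewrite /dotprod (bigD1 i)//= mxE !eqxx mulr1 big1 ?addr0// => j ji.
by rewrite mxE eqxx (negbTE ji) mulr0.
Qed.

Lemma dotprodC x y : dotprod x y = dotprod y x.
Proof. by apply: eq_bigr => i _; rewrite mulrC. Qed.

Lemma coord_le_enorm x i : `|x 0 i| <= enorm x.
Proof.
rewrite -sqrtr_sqr ler_sqrt; last by apply: sumr_ge0 => j _; rewrite -expr2 sqr_ge0.
rewrite /dotprod (bigD1 i)//= -expr2 lerDl sumr_ge0// => j _.
by rewrite -expr2 sqr_ge0.
Qed.

Lemma enorm_ge0 x : 0 <= enorm x.
Proof. exact: sqrtr_ge0. Qed.

Lemma enorm_gt0 x : x != 0 -> 0 < enorm x.
Proof.
move=> x0; rewrite lt_neqAle enorm_ge0 andbT eq_sym; apply: contra x0 => /eqP e0.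
apply/eqP/rowP => i; rewrite mxE; apply/eqP; rewrite -normr_le0 -e0.
exact: coord_le_enorm.
Qed.

(** Estimating coordinate by coordinate costs the factor [d] compared with Cauchy-Schwarz; only the
    powers of the norms matter later. *)
Lemma dotprod_le x y : `|dotprod x y| <= d%:R * enorm x * enorm y.
Proof.
apply: le_trans (ler_norm_sum _ _ _) _.
apply: (@le_trans _ _ (\sum_(i < d) enorm x * enorm y)).
  by apply: ler_sum => i _; rewrite normrM ler_pM ?coord_le_enorm.
by rewrite sumr_const card_ord -[leLHS]mulr_natl mulrA.
Qed.

End dotprod.

Section borel_functions.
Context (R : realType) (d : nat).

Lemma continuous_measurable_rV (f : 'rV[R]_d -> R) :
  continuous f -> measurable_fun (setT : set (borelRd R d)) f.
Proof.
move=> cf; apply: (measurability _ (RGenOpens.measurableE R)).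
move=> _ [_ [a [b ->]] <-]; rewrite setTI; apply: sub_sigma_algebra.
by apply: open_comp; [move=> x _; exact: cf|exact: interval_open].
Qed.

Lemma measurable_coord i : measurable_fun (setT : set (borelRd R d)) (fun x => x 0 i).
Proof. by apply: continuous_measurable_rV => x; exact: coord_continuous. Qed.

Lemma measurable_dotprod xi :
  measurable_fun (setT : set (borelRd R d)) (fun x => dotprod x xi).
Proof.
apply: measurable_sum => i; apply: measurable_funM => //; exact: measurable_coord.
Qed.

Lemma measurable_enorm : measurable_fun (setT : set (borelRd R d)) (@enorm R d).
Proof.
apply: (@measurableT_comp _ _ _ _ _ _ (@Num.sqrt R)).
  by apply: continuous_measurable_fun => x; exact: sqrt_continuous.
by apply: measurable_sum => i; apply: measurable_funM; exact: measurable_coord.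
Qed.

End borel_functions.

(** * The trigonometric closure and the indicators of Borel sets *)

Section trigonometric_closure.
Context (R : realType) (d : nat).
Implicit Types (f g : 'rV[R]_d -> R).

(** An inductive predicate, so that an identity between integrals of cosines propagates by induction
    on the derivation. The phase [c] makes sines available; the uniform bound in [trig_lim] is what
    dominated convergence asks for. *)
Inductive trig_closure : ('rV[R]_d -> R) -> Prop :=
| trig_cos xi c : trig_closure (fun x => cos (dotprod x xi + c))
| trig_add f g : trig_closure f -> trig_closure g ->
    trig_closure (fun x => f x + g x)
| trig_scale a f : trig_closure f -> trig_closure (fun x => a * f x)
| trig_lim (C : R) (F : nat -> 'rV[R]_d -> R) f :
    (forall n, trig_closure (F n)) -> (forall n x, `|F n x| <= C) ->
    (forall x, F n x @[n --> \oo] --> f x) -> trig_closure f.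

Lemma trig_eq f g : trig_closure f -> f =1 g -> trig_closure g.
Proof. by move=> tf /funext <-. Qed.

Lemma trig_cst a : trig_closure (cst a).
Proof.
apply: (trig_eq (trig_scale a (trig_cos 0 0))) => x.
by rewrite dotprod0r addr0 cos0 mulr1.
Qed.

Lemma trig_opp f : trig_closure f -> trig_closure (fun x => - f x).
Proof. by move=> /(trig_scale (-1)) tf; apply: (trig_eq tf) => x; rewrite mulN1r. Qed.

Lemma trig_sub f g : trig_closure f -> trig_closure g ->
  trig_closure (fun x => f x - g x).
Proof. by move=> tf /trig_opp; exact: trig_add. Qed.

Lemma trig_bounded f : trig_closure f -> exists C, forall x, `|f x| <= C.
Proof.
elim=> [xi c|f1 f2 _ [C1 f1C] _ [C2 f2C]|a f1 _ [C f1C]|C F g _ _ FC Fg].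
- by exists 1 => x; rewrite ler_norml cos_geN1 cos_le1.
- by exists (C1 + C2) => x; rewrite (le_trans (ler_normD _ _))// lerD.
- by exists (`|a| * C) => x; rewrite normrM ler_wpM2l.
- exists C => x; apply: (@closed_cvg _ _ _ eventually_filter
    (fun n => `|F n x|) [set y | y <= C]).
  + exact: closed_le.
  + by apply: nearW => n; exact: FC.
  + by apply: cvg_norm; exact: Fg.
Qed.

Lemma trig_measurable f : trig_closure f ->
  measurable_fun (setT : set (borelRd R d)) f.
Proof.
elim=> [xi c|f1 f2 _ mf1 _ mf2|a f1 _ mf1|C F g _ mF _ Fg].
- apply: (@measurableT_comp _ _ _ _ _ _ (@cos R)).
    by apply: continuous_measurable_fun => x; exact: continuous_cos.
  by apply: measurable_funD => //; exact: measurable_dotprod.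
- exact: measurable_funD.
- exact: measurable_funM.
- by apply: (measurable_fun_cvg mF) => x _; exact: Fg.
Qed.

(** Induction on both factors, down to a product of two cosines. At a limit the other factor is
    bounded, so the products are again uniformly bounded. *)
Lemma trig_mul f g : trig_closure f -> trig_closure g ->
  trig_closure (fun x => f x * g x).
Proof.
have lim_mul (h : 'rV[R]_d -> R) C (F : nat -> 'rV[R]_d -> R) (k : 'rV[R]_d -> R) :
    trig_closure h -> (forall n, trig_closure (fun x => F n x * h x)) ->
    (forall n x, `|F n x| <= C) -> (forall x, F n x @[n --> \oo] --> k x) ->
    trig_closure (fun x => k x * h x).
  move=> /trig_bounded[D hD] tF FC Fk; apply: (@trig_lim (C * D) _ _ tF) => [n x|x].
    by rewrite normrM ler_pM.
  by apply: cvgMl.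
move=> tf tg; elim: tf g tg => [xi c|f1 f2 _ tf1 _ tf2|a f1 _ tf1|C F h _ tF FC Fh] g tg.
- elim: tg => [eta e|g1 g2 _ tg1 _ tg2|a g1 _ tg1|C G h _ tG GC Gh].
  (* Product-to-sum formula: cos A cos B is half of cos(A + B) + cos(A - B). *)
  + have := trig_scale 2^-1 (trig_add (trig_cos (xi + eta) (c + e))
      (trig_cos (xi - eta) (c - e))).
    move/trig_eq; apply => x; rewrite !dotprodDr dotprodNr.
    rewrite (addrACA _ _ c e) (addrACA _ _ c) -opprD.
    by rewrite (cosD (_ + c)) (cosB (_ + c)); field.
  + by apply: (trig_eq (trig_add tg1 tg2)) => x; rewrite mulrDr.
  + by apply: (trig_eq (trig_scale a tg1)) => x; rewrite mulrCA.
  + have tGc n : trig_closure (fun x => G n x * cos (dotprod x xi + c)).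
      by apply: (trig_eq (tG n)) => x; rewrite mulrC.
    by apply: (trig_eq (lim_mul _ _ _ _ (trig_cos xi c) tGc GC Gh)) => x; rewrite mulrC.
- by apply: (trig_eq (trig_add (tf1 _ tg) (tf2 _ tg))) => x; rewrite mulrDl.
- by apply: (trig_eq (trig_scale a (tf1 _ tg))) => x; rewrite mulrA.
- exact: (lim_mul _ _ _ _ tg (fun n => tF n _ tg) FC Fh).
Qed.

End trigonometric_closure.

Section sign_iteration.
Context (R : realType).

(* The fixed points of this odd cubic on [-1, 1] are -1, 0 and 1; the first and
   the last are attracting. *)
Definition sgn_step (s : R) : R := s * (3 - s ^+ 2) / 2.

Lemma sgn_stepN s : sgn_step (- s) = - sgn_step s.
Proof. by rewrite /sgn_step sqrrN !mulNr. Qed.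

Lemma iter_sgn_stepN n s : iter n sgn_step (- s) = - iter n sgn_step s.
Proof. by elim: n => //= n ->; rewrite sgn_stepN. Qed.

(** One step multiplies the gap 1 - t by 1 - (t + t^2)/2, which is at most 1 - s/2 as long as the
    iterate t stays above its start s; hence geometric convergence. *)
Lemma iter_sgn_step_pos n s : 0 < s <= 1 ->
  s <= iter n sgn_step s <= 1 /\ 1 - iter n sgn_step s <= (1 - s / 2) ^+ n.
Proof.
move=> /andP[s0 s1]; elim: n => [|n [/andP[sn n1] IH]].
  by rewrite lexx s1 expr0/=; split => //; lra.
rewrite iterS exprS; set t := iter n sgn_step s in sn n1 IH *.
have t0 : 0 < t by exact: lt_le_trans sn.
have tE : 1 - sgn_step t = (1 - t) * (1 - (t + t ^+ 2) / 2).
  by rewrite /sgn_step; field.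
have t2 : 0 <= t ^+ 2 <= 1 by rewrite sqr_ge0 expr_le1// ltW.
have step_ge : t <= sgn_step t by rewrite /sgn_step; nra.
have step_le : sgn_step t <= 1 by rewrite -subr_ge0 tE; apply: mulr_ge0; lra.
split; first by rewrite (le_trans sn).
rewrite tE mulrC; apply: ler_pM => //; lra.
Qed.

Lemma iter_sgn_step_bounded n s : `|s| <= 1 -> `|iter n sgn_step s| <= 1.
Proof.
have [s0|s0|<-] := ltgtP 0 s; last 1 first.
- rewrite normr0 => _; suff -> : iter n sgn_step 0 = 0 by rewrite normr0.
  by elim: n => //= n ->; rewrite /sgn_step !mul0r.
- rewrite gtr0_norm// => s1.
  have [|/andP[? ?] _] := @iter_sgn_step_pos n s; first by rewrite s0.
  by rewrite ger0_norm// (le_trans (ltW s0)).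
- rewrite ltr0_norm// => s1.
  have [|/andP[? ?] _] := @iter_sgn_step_pos n (- s); first by rewrite oppr_gt0 s0.
  rewrite -normrN -iter_sgn_stepN ger0_norm//.
  by apply: (@le_trans _ _ (- s)) => //; lra.
Qed.

Lemma cvg_iter_sgn_step s : `|s| <= 1 -> iter n sgn_step s @[n --> \oo] --> Num.sg s.
Proof.
have pos t : 0 < t <= 1 -> iter n sgn_step t @[n --> \oo] --> (1 : R).
  move=> t01; apply: (@squeeze_cvgr _ _ _ _ (fun n => 1 - (1 - t / 2) ^+ n) (cst 1)).
  - apply: nearW => n; have [/andP[_ n1] h] := iter_sgn_step_pos n t01.
    by rewrite n1 andbT; lra.
  - rewrite -[X in _ --> X]subr0; apply: cvgB; first exact: cvg_cst.
    by apply: cvg_expr; case/andP: t01 => ? ?; rewrite ger0_norm; lra.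
  - exact: cvg_cst.
have [s0|s0|<-] := ltgtP 0 s; last 1 first.
- move=> _; rewrite sgr0 (_ : (fun n => _) = cst 0); first exact: cvg_cst.
  by apply/funext; elim=> //= n ->; rewrite /sgn_step !mul0r.
- by rewrite gtr0_norm// => s1; rewrite gtr0_sg//; apply: pos; rewrite s0.
- rewrite ltr0_norm// => s1; rewrite ltr0_sg//.
  rewrite (_ : (fun n => _) = fun n => - iter n sgn_step (- s)).
    by apply: cvgN; apply: pos; rewrite oppr_gt0 s0.
  by apply/funext => n; rewrite iter_sgn_stepN opprK.
Qed.

End sign_iteration.

Section trigonometric_indicators.
Context (R : realType) (d : nat).
Implicit Types (f g : 'rV[R]_d -> R) (A B : set 'rV[R]_d).

(** The iterates of the cubic are polynomials in [f], hence in the closure by [trig_mul], and they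
    stay in [-1, 1]. *)
Lemma trig_sgr f : trig_closure f -> (forall x, `|f x| <= 1) ->
  trig_closure (fun x => Num.sg (f x)).
Proof.
move=> tf f1; apply: (@trig_lim _ _ 1 (fun n x => iter n (@sgn_step R) (f x))).
- elim=> //= n IH.
  apply: (trig_eq (trig_scale 2^-1 (trig_mul IH
     (trig_sub (trig_cst d 3) (trig_mul IH IH))))) => x.
  by rewrite /sgn_step /cst expr2 mulrC.
- by move=> n x; exact: iter_sgn_step_bounded.
- by move=> x; exact: cvg_iter_sgn_step.
Qed.

(** A coordinate is unbounded, so it is not itself in the closure. Its sign relative to a is that of
    sin((x_i - a)/(n+1)) as soon as |x_i - a| < (n+1) pi; at each point the sequence of signs is
    eventually constant. *)
Lemma trig_sgr_coord i a : trig_closure (fun x : 'rV[R]_d => Num.sg (x 0 i - a)).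
Proof.
apply: (@trig_lim _ _ 1 (fun n x => Num.sg (sin ((x 0 i - a) / n.+1%:R)))).
- move=> n; apply: trig_sgr => [|x]; last by rewrite ler_norml sin_geN1 sin_le1.
  apply: (trig_eq (trig_cos (n.+1%:R^-1 *: delta_mx 0 i) (- (a / n.+1%:R) - pi / 2))) => x.
  by rewrite dotprodZr dotprod_delta addrA cosBpihalf mulrBl mulrC.
- by move=> n x; rewrite normr_sg; case: eqP.
- move=> x; apply: cvg_near_cst; near=> n.
  set t := x 0 i - a; have n0 : 0 < n.+1%:R :> R by rewrite ltr0n.
  have tpi : `|t| / n.+1%:R < pi.
    rewrite ltr_pdivrMr//.
    have pi1 : 1 <= pi :> R by have := pi_ge2 R; lra.
    apply: (@lt_le_trans _ _ n.+1%:R); last by rewrite ler_peMl// ltW.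
    apply: (@lt_trans _ _ n%:R); last by rewrite ltr_nat.
    by near: n; exact: nbhs_infty_gtr.
  have [t0|t0|<-] := ltgtP 0 t; last by rewrite mul0r sin0.
  + rewrite (gtr0_sg t0) gtr0_sg//; apply: sin_gt0_pi.
    by rewrite divr_gt0//= -(ger0_norm (ltW t0)).
  + rewrite (ltr0_sg t0) ltr0_sg// -oppr_gt0 -sinN -mulNr.
    by apply: sin_gt0_pi; rewrite divr_gt0 ?oppr_gt0//= -(ltr0_norm t0).
Unshelve. all: by end_near. Qed.

End trigonometric_indicators.

Section trigonometric_sets.
Context (R : realType) (d : nat).
Implicit Types (A B : set 'rV[R]_d).

Definition trig_set A := trig_closure (\1_A : 'rV[R]_d -> R).

Lemma trig_setC A : trig_set A -> trig_set (~` A).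
Proof.
move=> tA; apply: (trig_eq (trig_sub (trig_cst d 1) tA)) => x.
by rewrite /cst !indicE in_setC; case: (_ \in _); rewrite /= ?subrr ?subr0.
Qed.

Lemma trig_setI A B : trig_set A -> trig_set B -> trig_set (A `&` B).
Proof.
by move=> tA tB; apply: (trig_eq (trig_mul tA tB)) => x; rewrite indicI.
Qed.

Lemma trig_set0 : trig_set set0.
Proof. by apply: (trig_eq (trig_cst d 0)) => x; rewrite indic0. Qed.

Lemma trig_setU A B : trig_set A -> trig_set B -> trig_set (A `|` B).
Proof.
move=> tA tB; rewrite -[_ `|` _]setCK setCU; apply: trig_setC.
by apply: trig_setI; exact: trig_setC.
Qed.

Lemma trig_bigcup (F : nat -> set 'rV[R]_d) :
  (forall n, trig_set (F n)) -> trig_set (\bigcup_n F n).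
Proof.
move=> tF; apply: (@trig_lim _ _ 1 (fun n => \1_(\big[setU/set0]_(i < n) F i))).
- elim=> [|n IH]; first by rewrite big_ord0; exact: trig_set0.
  by rewrite big_ord_recr; exact: trig_setU.
- by move=> n x; rewrite indicE; case: (_ \in _); rewrite /= ?normr1// normr0.
- move=> x; apply: cvg_near_cst.
  have [[k _ Fk]|nF] := pselect ((\bigcup_n F n) x).
    near=> n; rewrite !indicE !mem_set//; first by exists k.
    rewrite -bigcup_mkord; exists k => //=; near: n; exact: nbhs_infty_gt.
  apply: nearW => n; rewrite !indicE !memNset//.
  by rewrite -bigcup_mkord => -[k _ Fk]; apply: nF; exists k.
Unshelve. all: by end_near. Qed.

(** For s in {-1, 0, 1}, (s^2 + s)/2 is the indicator of s = 1; in [trig_lt_coord], (s^2 - s)/2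
    detects s = -1. *)
Lemma trig_gt_coord i a : trig_set [set x | a < x 0 i].
Proof.
have ts := trig_sgr_coord i a.
apply: (trig_eq (trig_scale 2^-1 (trig_add (trig_mul ts ts) ts))) => x.
rewrite indicE; have [xa|xa|xa] := ltgtP 0 (x 0 i - a).
- by rewrite mem_set/= ?gtr0_sg//; [field|lra].
- by rewrite memNset ?ltr0_sg//=; [field|apply/negP; rewrite -leNgt; lra].
- by rewrite memNset/= -?xa ?sgr0; [field|apply/negP; rewrite -leNgt; lra].
Qed.

Lemma trig_lt_coord i a : trig_set [set x | x 0 i < a].
Proof.
have ts := trig_sgr_coord i a.
apply: (trig_eq (trig_scale 2^-1 (trig_sub (trig_mul ts ts) ts))) => x.
rewrite indicE; have [xa|xa|xa] := ltgtP 0 (x 0 i - a).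
- by rewrite memNset ?gtr0_sg//=; [field|apply/negP; rewrite -leNgt; lra].
- by rewrite mem_set/= ?ltr0_sg//; [field|lra].
- by rewrite memNset/= -?xa ?sgr0; [field|apply/negP; rewrite -leNgt; lra].
Qed.

Lemma trig_eq_coord i a : trig_set [set x | x 0 i = a].
Proof.
have := trig_setI (trig_setC (trig_lt_coord i a)) (trig_setC (trig_gt_coord i a)).
congr trig_set; apply/seteqP; split => x /= => [[/negP + /negP]|->].
  by rewrite -!leNgt => ? ?; apply/eqP; rewrite eq_le; apply/andP.
by rewrite ltxx.
Qed.

Lemma trig_forall_coord (P : 'I_d -> set R) :
  (forall i, trig_set [set y | P i (y 0 i)]) ->
  trig_set [set y | forall i, P i (y 0 i)].
Proof.
move=> tP; have : trig_set [set y | forall i, i \in enum 'I_d -> P i (y 0 i)].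
  elim: (enum _) => [|i s IH].
    by have := trig_setC trig_set0; congr trig_set; rewrite setC0; apply/seteqP; split.
  have := trig_setI (tP i) IH; congr trig_set; apply/seteqP; split => y /=.
    by move=> [Pi Ps] j; rewrite in_cons => /predU1P[->//|]; exact: Ps.
  by move=> Pj; split=> [|j js]; apply: Pj; rewrite in_cons ?eqxx// js orbT.
by congr trig_set; apply/seteqP; split => y /= Py i *; apply: Py; rewrite ?mem_enum.
Qed.

(** Balls of the sup norm are open boxes, that is finite intersections of coordinate half-spaces. *)
Lemma trig_ball (x : 'rV[R]_d) (r : R) : 0 < r -> trig_set (ball x r).
Proof.
move=> r0; pose P i := [set t | x 0 i - r < t] `&` [set t | t < x 0 i + r].
suff <- : [set y : 'rV[R]_d | forall i, P i (y 0 i)] = ball x r.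
  apply: trig_forall_coord => i.
  by apply: trig_setI; [exact: trig_gt_coord|exact: trig_lt_coord].
apply/seteqP; split => y /= => [xy|[_ xy] i].
  split=> // j i; rewrite (ord1 j); have [] := xy i; rewrite /ball/= => ? ?.
  by rewrite distrC ltr_distl; apply/andP.
by have := xy 0 i; rewrite /ball/= distrC ltr_distl => /andP[? ?]; split.
Qed.

Lemma trig_open A : open A -> trig_set A.
Proof.
(* [F] runs through the balls with rational centre [q] and radius 1/(k+1) that lie inside [A]; the
   countably many pairs (q, k) are coded by integers. *)
move=> oA; pose F n := if unpickle n is Some (q, k)
  then let B := ball (map_mx (@ratr R) (q : 'rV[rat]_d)) k.+1%:R^-1 in
       if `[< B `<=` A >] then B else set0 else set0.
suff -> : A = \bigcup_n F n.
  apply: trig_bigcup => n; rewrite /F; case: unpickle => [[q k]|]; last exact: trig_set0.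
  by case: ifPn => _; [exact: trig_ball|exact: trig_set0].
apply/seteqP; split => [x Ax|x [n _]]; last first.
  rewrite /F; case: unpickle => [[q k]|//]; case: ifPn => [/asboolP + |//].
  exact.
have /nbhs_ballP[e /= e0 eA] : nbhs x A by exact: open_nbhs_nbhs.
have [k ke] : exists k, k.+1%:R^-1 < e / 2.
  have e20 : 0 < e / 2 by rewrite divr_gt0.
  by have [N _ h] := near_infty_natSinv_lt (PosNum e20); exists N; exact: (h N (leqnn N)).
(* A rational centre within 1/(k+1) < e/2 of x: its ball contains x and stays inside the ball of
   radius e around x. *)
have /(_ _)/cid qx i : exists q : rat, ball (x 0 i) k.+1%:R^-1 (ratr q).
  have := @rat_in_itvoo R (x 0 i - k.+1%:R^-1) (x 0 i + k.+1%:R^-1).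
  case; first by rewrite ltrD2l gtrN// invr_gt0.
  move=> q; rewrite in_itv/= => /andP[? ?]; exists q.
  by rewrite /ball/= distrC ltr_distl; apply/andP.
exists (pickle (\row_i sval (qx i), k)) => //; rewrite /F pickleK /=.
pose c : 'rV[R]_d := map_mx ratr (\row_i sval (qx i)); rewrite -/c.
have xB : ball c k.+1%:R^-1 x.
  split; first by rewrite invr_gt0.
  by move=> j i; rewrite (ord1 j) !mxE; apply: ball_sym; exact: (svalP (qx i)).
rewrite asboolT// => y yB; apply: eA.
apply: (@ball_split _ _ c).
  by apply/ball_sym; apply: le_ball (ltW ke) _ xB.
exact: le_ball (ltW ke) _ yB.
Qed.

(** The sets whose indicator is in the closure form a sigma-algebra, and it contains the open
    sets. *)
Lemma trig_borel A : measurable (A : set (borelRd R d)) -> trig_set A.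
Proof.
apply: smallest_sub => [|B oB]; last exact: trig_open.
split=> [|B tB|F tF]; first exact: trig_set0.
  by rewrite setTD; exact: trig_setC.
exact: trig_bigcup.
Qed.

End trigonometric_sets.

(** * Integration against charges and uniqueness of the Fourier transform *)

Section charge_pairing.
Context (dsp : measure_display) (T : measurableType dsp) (R : realType).
Implicit Types (nu : {charge set T -> \bar R}) (f g : T -> R).

Definition charge_integrable nu f :=
  (hpos nu).-integrable setT (EFin \o f) /\ (hneg nu).-integrable setT (EFin \o f).

Lemma charge_integralD nu f g : charge_integrable nu f -> charge_integrable nu g ->
  charge_integral nu (fun x => f x + g x) = charge_integral nu f + charge_integral nu g.
Proof.
by move=> [f1 f2] [g1 g2]; rewrite /charge_integral !RintegralD//; ring.
Qed.

Lemma charge_integralZ nu a f : charge_integrable nu f ->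
  charge_integral nu (fun x => a * f x) = a * charge_integral nu f.
Proof. by move=> [f1 f2]; rewrite /charge_integral !RintegralZl// mulrBr. Qed.

Lemma charge_integralN nu f : charge_integrable nu f ->
  charge_integral nu (fun x => - f x) = - charge_integral nu f.
Proof.
move=> nuf; rewrite -mulN1r -charge_integralZ//; congr charge_integral.
by apply/funext => x; rewrite mulN1r.
Qed.

Lemma charge_integralB nu f g : charge_integrable nu f -> charge_integrable nu g ->
  charge_integral nu (fun x => f x - g x) = charge_integral nu f - charge_integral nu g.
Proof.
by move=> [f1 f2] [g1 g2]; rewrite /charge_integral !RintegralB//; ring.
Qed.

Lemma charge_integrableD nu f g : charge_integrable nu f -> charge_integrable nu g ->
  charge_integrable nu (fun x => f x + g x).
Proof.
move=> [f1 f2] [g1 g2]; split.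
  by have := integrableD measurableT f1 g1; exact.
by have := integrableD measurableT f2 g2; exact.
Qed.

Lemma charge_integrableZ nu a f : charge_integrable nu f ->
  charge_integrable nu (fun x => a * f x).
Proof.
move=> [f1 f2]; split.
  by have := integrableZl measurableT a f1; exact.
by have := integrableZl measurableT a f2; exact.
Qed.

Lemma charge_integrableB nu f g : charge_integrable nu f -> charge_integrable nu g ->
  charge_integrable nu (fun x => f x - g x).
Proof.
move=> [f1 f2] [g1 g2]; split.
  by have := integrableB measurableT f1 g1; exact.
by have := integrableB measurableT f2 g2; exact.
Qed.

Lemma charge_integrable_sum nu I (r : seq I) (F : I -> T -> R) :
  (forall i, charge_integrable nu (F i)) ->
  charge_integrable nu (fun x => \sum_(i <- r) F i x).
Proof.
move=> iF; elim: r => [|i r IH].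
  under eq_fun do rewrite big_nil; split; exact: integrable0.
by under eq_fun do rewrite big_cons; exact: charge_integrableD.
Qed.

Lemma charge_integral0 nu : charge_integral nu (cst 0) = 0.
Proof. by rewrite /charge_integral !Rintegral_cst// !mul0r subr0. Qed.

Lemma charge_integral_sum nu I (r : seq I) (F : I -> T -> R) :
  (forall i, charge_integrable nu (F i)) ->
  charge_integral nu (fun x => \sum_(i <- r) F i x) =
  \sum_(i <- r) charge_integral nu (F i).
Proof.
move=> iF; elim: r => [|i r IH].
  by rewrite big_nil; under eq_fun do rewrite big_nil; exact: charge_integral0.
under eq_fun do rewrite big_cons.
by rewrite charge_integralD// ?IH ?big_cons//; exact: charge_integrable_sum.
Qed.

Lemma charge_integrable_bounded nu f (C : R) :
  measurable_fun setT f -> (forall x, `|f x| <= C) -> charge_integrable nu f.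
Proof. by move=> mf fC; split; exact: (bounded_integrable _ mf fC). Qed.

Lemma charge_integrable_le nu f g : measurable_fun setT f ->
  (forall x, `|f x| <= g x) -> charge_integrable nu g -> charge_integrable nu f.
Proof.
move=> mf fg [g1 g2].
have fg' x : setT x -> (`|(EFin \o f) x| <= `|(EFin \o g) x|)%E.
  by move=> _; rewrite lee_fin (le_trans (fg x))// ler_norm.
by split; [move: g1|move: g2]; apply: le_integrable => //; exact/measurable_EFinP.
Qed.

(** This is the integral of [g] against the total variation of the real charge [nu]. *)
Definition charge_mass nu g := \int[hpos nu]_x g x + \int[hneg nu]_x g x.

Lemma charge_integral_le nu f g : measurable_fun setT f ->
  (forall x, `|f x| <= g x) -> charge_integrable nu g ->
  `|charge_integral nu f| <= charge_mass nu g.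
Proof.
move=> mf fg ig; have [f1 f2] := charge_integrable_le mf fg ig.
have [g1 g2] := ig.
apply: le_trans (ler_normB _ _) _; apply: lerD.
  apply: le_trans (le_normr_Rintegral _ f1) _ => //.
  by apply: le_Rintegral => //; exact: integrable_norm.
apply: le_trans (le_normr_Rintegral _ f2) _ => //.
by apply: le_Rintegral => //; exact: integrable_norm.
Qed.

Lemma Rintegral_bounded_cvg (P : {finite_measure set T -> \bar R}) (C : R) (F : nat -> T -> R) f :
  (forall n, measurable_fun setT (F n)) -> measurable_fun setT f ->
  (forall n x, `|F n x| <= C) ->
  (forall x, F n x @[n --> \oo] --> f x) ->
  \int[P]_x F n x @[n --> \oo] --> \int[P]_x f x.
Proof.
move=> mF mf FC Ff.
have iC : P.-integrable setT (EFin \o cst C).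
  exact: finite_measure_integrable_cst.
have [||||if_ _] := @dominated_convergence _ T R P setT measurableT
  (fun n => EFin \o F n) (EFin \o f) (EFin \o cst C) _ _ _ iC.
- by move=> n; exact/measurable_EFinP.
- exact/measurable_EFinP.
- by apply: aeW => x _; apply: cvg_EFin; [exact: nearW|exact: Ff].
- by apply: aeW => x n _; rewrite /= lee_fin.
rewrite -[X in _ --> X]fineK; last exact: integrable_fin_num.
by move/fine_cvgP => [_].
Qed.

Lemma charge_integral_bounded_cvg nu (C : R) (F : nat -> T -> R) f :
  (forall n, measurable_fun setT (F n)) -> measurable_fun setT f ->
  (forall n x, `|F n x| <= C) ->
  (forall x, F n x @[n --> \oo] --> f x) ->
  charge_integral nu (F n) @[n --> \oo] --> charge_integral nu f.
Proof. by move=> mF mf FC Ff; apply: cvgB; exact: Rintegral_bounded_cvg FC Ff. Qed.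

Lemma charge_integral_indic nu (A : set T) : measurable A ->
  (charge_integral nu \1_A)%:E = nu A.
Proof.
move=> mA; rewrite hahn_parts// /charge_integral /Rintegral !integral_indic// !setIT.
by rewrite EFinB !fineK// fin_num_measure.
Qed.

End charge_pairing.

Section trigonometric_uniqueness.
Context (R : realType) (d : nat).
Implicit Types (nu : {charge set (borelRd R d) -> \bar R}) (f : 'rV[R]_d -> R).

Lemma trig_charge_integrable nu f : trig_closure f -> charge_integrable nu f.
Proof.
move=> tf; have [C fC] := trig_bounded tf.
exact: charge_integrable_bounded (trig_measurable tf) fC.
Qed.

(** Induction along the derivation that puts the indicator of [A] in the trigonometric closure; the
    limit case is bounded convergence on both sides. *)
Lemma trig_charge_unique nu1 nu2 :
  (forall xi c, charge_integral nu1 (fun x => cos (dotprod x xi + c)) =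
                charge_integral nu2 (fun x => cos (dotprod x xi + c))) ->
  forall A, measurable A -> nu1 A = nu2 A.
Proof.
move=> nu12 A mA; rewrite -!charge_integral_indic//; congr (_%:E).
elim: (trig_borel mA) => [xi c|f g tf IHf tg IHg|a f tf IHf|C F f tF IHF FC Ff].
- exact: nu12.
- by rewrite !charge_integralD ?IHf ?IHg//; exact: trig_charge_integrable.
- by rewrite !charge_integralZ ?IHf//; exact: trig_charge_integrable.
- have tf := trig_measurable (trig_lim tF FC Ff).
  have mF n := trig_measurable (tF n).
  have c1 := charge_integral_bounded_cvg (nu := nu1) mF tf FC Ff.
  have c2 := charge_integral_bounded_cvg (nu := nu2) mF tf FC Ff.
  rewrite (funext IHF) in c1; exact: (cvg_unique _ c1 c2).
Qed.

End trigonometric_uniqueness.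

Section complex_pairing.
Context (dsp : measure_display) (T : measurableType dsp) (R : realType).
Implicit Types (mu nu : cmeasure T R) (f g : T -> R).

Definition cm_integrable mu f :=
  charge_integrable (cm_re mu) f /\ charge_integrable (cm_im mu) f.

Lemma cintegral_real mu f : cintegral mu (fun x => (f x)%:C) =
  charge_integral (cm_re mu) f +i* charge_integral (cm_im mu) f.
Proof. by rewrite /cintegral/= !charge_integral0 subr0 add0r. Qed.

(** Trades the bare set function [total_variation] for the four Hahn parts, against which integrals
    are linear. Each part is dominated by the total variation, which in turn is dominated by their
    sum. *)
Lemma cm_integrable_tvar mu f : measurable_fun setT f -> (forall x, 0 <= f x) ->
  (\int[Defs.total_variation mu]_x (f x)%:E < +oo)%E <-> cm_integrable mu f.
Proof.
move=> mf f0; have f0' x : (0 <= (f x)%:E)%E by rewrite lee_fin.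
have mf' : measurable_fun setT (EFin \o f) by exact/measurable_EFinP.
have integrableE (P : {measure set T -> \bar R}) :
    (\int[P]_x (f x)%:E < +oo)%E <-> P.-integrable setT (EFin \o f).
  have E : (\int[P]_x `|(EFin \o f) x| = \int[P]_x (f x)%:E)%E.
    by apply: eq_integral => x _; rewrite /= ger0_norm.
  split => [Pf|/integrableP[_]]; last by rewrite E.
  by apply/integrableP; split => //; rewrite E.
split => [/(tvar_integral_hahn f0')[]|[[? ?] [? ?]]].
  by do 4 move=> /integrableE ?.
by apply: (tvar_integral_lty (cm_split_hahn mu)) => //; split; exact/integrableE.
Qed.

Lemma cm_parts_eq mu nu :
  (forall A, measurable A -> cm_re mu A = cm_re nu A) ->
  (forall A, measurable A -> cm_im mu A = cm_im nu A) -> mu = nu.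
Proof.
move=> re im; apply: (cm_split_eq (cm_split_hahn mu)); have [s1 s2] := cm_split_hahn mu.
by split=> A mA; [rewrite -[LHS]re// s1|rewrite -[LHS]im// s2].
Qed.

End complex_pairing.

Section fourier_pairing.
Context (R : realType) (d : nat).
Implicit Types (mu nu : cmeasure (borelRd R d) R) (xi x : 'rV[R]_d).

Definition re_cos mu xi c :=
  charge_integral (cm_re mu) (fun x : borelRd R d => cos (dotprod x xi + c)).
Definition im_cos mu xi c :=
  charge_integral (cm_im mu) (fun x : borelRd R d => cos (dotprod x xi + c)).

Let sinE (t : R) : sin t = cos (t + - (pi / 2)).
Proof. by rewrite cosBpihalf. Qed.

Let cosND (t c : R) : cos (- t + c) = cos (t - c).
Proof. by rewrite -cosN opprD opprK. Qed.

(** Writing the sine as a cosine of phase -pi/2 keeps a single family of test functions. *)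
Lemma fourierE mu xi : fourier mu xi =
  (re_cos mu xi 0 + im_cos mu xi (- (pi / 2))) +i*
  (im_cos mu xi 0 - re_cos mu xi (- (pi / 2))).
Proof.
have cos0 : (fun x : 'rV[R]_d => cos (dotprod x xi)) = (fun x => cos (dotprod x xi + 0)).
  by apply/funext => x; rewrite addr0.
have sinN : (fun x : 'rV[R]_d => - sin (dotprod x xi)) =
    (fun x => - cos (dotprod x xi + - (pi / 2))).
  by apply/funext => x; rewrite -sinE.
have tc m := trig_charge_integrable m (trig_cos xi (- (pi / 2))).
rewrite /fourier /cintegral/= cos0 sinN (charge_integralN (tc _)) (charge_integralN (tc _)).
by rewrite opprK [X in _ +i* X]addrC.
Qed.

Let charge_cosN (nu : {charge set (borelRd R d) -> \bar R}) (xi : 'rV[R]_d) c :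
  charge_integral nu (fun x : borelRd R d => cos (dotprod x (- xi) + c)) =
  charge_integral nu (fun x : borelRd R d => cos (dotprod x xi - c)).
Proof. by congr charge_integral; apply/funext => x; rewrite dotprodNr cosND. Qed.

Let charge_cosD (nu : {charge set (borelRd R d) -> \bar R}) (xi : 'rV[R]_d) c :
  charge_integral nu (fun x : borelRd R d => cos (dotprod x xi + c)) =
  cos c * charge_integral nu (fun x : borelRd R d => cos (dotprod x xi + 0)) -
  sin c * charge_integral nu (fun x : borelRd R d => cos (dotprod x xi + - (pi / 2))).
Proof.
have tc := fun e => trig_charge_integrable nu (trig_cos xi e).
rewrite -!charge_integralZ// -charge_integralB//; try exact: charge_integrableZ.
congr charge_integral; apply/funext => x.
by rewrite -sinE addr0 cosD; ring.
Qed.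

Let charge_cosNpihalf (nu : {charge set (borelRd R d) -> \bar R}) (xi : 'rV[R]_d) :
  charge_integral nu (fun x : borelRd R d => cos (dotprod x xi - - (pi / 2))) =
  - charge_integral nu (fun x : borelRd R d => cos (dotprod x xi + - (pi / 2))).
Proof.
have tc := fun e => trig_charge_integrable nu (trig_cos xi e).
rewrite -charge_integralN//; congr charge_integral; apply/funext => x.
by rewrite opprK -sinE cosDpihalf.
Qed.

(** Each component of the transform of a complex [mu] mixes cosine integrals of one part with sine
    integrals of the other. Taking even and odd parts in xi separates them, which is why both xi and
    -xi occur. *)
Lemma re_cosE mu xi c : re_cos mu xi c =
  cos c * ((complex.Re (fourier mu xi) + complex.Re (fourier mu (- xi))) / 2) +
  sin c * ((complex.Im (fourier mu xi) - complex.Im (fourier mu (- xi))) / 2).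
Proof.
rewrite !fourierE/= /re_cos /im_cos !charge_cosN oppr0 !charge_cosNpihalf.
by rewrite [LHS]charge_cosD; field.
Qed.

Lemma im_cosE mu xi c : im_cos mu xi c =
  cos c * ((complex.Im (fourier mu xi) + complex.Im (fourier mu (- xi))) / 2) -
  sin c * ((complex.Re (fourier mu xi) - complex.Re (fourier mu (- xi))) / 2).
Proof.
rewrite !fourierE/= /re_cos /im_cos !charge_cosN oppr0 !charge_cosNpihalf.
by rewrite [LHS]charge_cosD; field.
Qed.

Lemma fourier_unique mu nu : (forall xi, fourier mu xi = fourier nu xi) -> mu = nu.
Proof.
move=> munu; apply: cm_parts_eq; apply: trig_charge_unique => xi c.
  by have := re_cosE mu xi c; rewrite !munu -re_cosE.
by have := im_cosE mu xi c; rewrite !munu -im_cosE.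
Qed.

Lemma fourier_dist_le mu nu xi :
  Normc.normc (fourier mu xi - fourier nu xi) <=
  `|re_cos mu xi 0 - re_cos nu xi 0| +
  `|im_cos mu xi (- (pi / 2)) - im_cos nu xi (- (pi / 2))| +
  (`|im_cos mu xi 0 - im_cos nu xi 0| +
  `|re_cos mu xi (- (pi / 2)) - re_cos nu xi (- (pi / 2))|).
Proof.
apply: le_trans (normc_le_ReIm _) _; rewrite ReB ImB !fourierE/=; apply: lerD.
  by rewrite opprD addrACA ler_normD.
move: (im_cos mu xi 0) (re_cos mu xi _) (im_cos nu xi 0) (re_cos nu xi _) => a b a' b'.
by rewrite (_ : a - b - (a' - b') = (a - a') - (b - b')) ?ler_normB//; ring.
Qed.

(** The coefficients cos c and sin c of [re_cosE] have modulus at most 1. This turns closeness of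
    the transforms, which d_m controls, into closeness of cosine integrals of any phase. *)
Lemma re_cos_dist_le mu nu xi c : `|re_cos mu xi c - re_cos nu xi c| <=
  Normc.normc (fourier mu xi - fourier nu xi) +
  Normc.normc (fourier mu (- xi) - fourier nu (- xi)).
Proof.
set D := fourier mu xi - _; set D' := fourier mu (- xi) - _.
have -> : re_cos mu xi c - re_cos nu xi c =
    cos c * ((complex.Re D + complex.Re D') / 2) + sin c * ((complex.Im D - complex.Im D') / 2).
  rewrite (re_cosE mu) (re_cosE nu) /D /D' !ReB !ImB.
  case: (fourier mu xi) (fourier mu _) (fourier nu xi) (fourier nu _)
    => [a a'] [b b'] [e e'] [f f'] /=.
  by move: (cos c) (sin c) 2^-1 => u v h; ring.
have half (t a b A B : R) : `|t| <= 1 -> `|a| <= A -> `|b| <= B ->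
    `|t * ((a + b) / 2)| <= (A + B) / 2.
  move=> t1 aA bB; rewrite normrM -[leRHS]mul1r ler_pM//.
  by rewrite normrM [`|2^-1|]ger0_norm// ler_wpM2r// (le_trans (ler_normD _ _))// lerD.
rewrite [leRHS]splitr; apply: le_trans (ler_normD _ _) _; apply: lerD; apply: half.
- by rewrite ler_norml cos_geN1 cos_le1.
- exact: Re_le_normc.
- exact: Re_le_normc.
- by rewrite ler_norml sin_geN1 sin_le1.
- exact: Im_le_normc.
- by rewrite normrN; exact: Im_le_normc.
Qed.

End fourier_pairing.

(** * Taylor approximation, equal moments and finiteness of the distance *)

Section cosine_approximation.
Context (R : realType).

(** The derivative of cos(t + c) is cos(t + (c + pi/2)), so the induction runs over all phases at
    once; the mean value theorem supplies one more factor |t|. *)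
Lemma cos_poly_approx n (c : R) : exists2 p : {poly R}, (size p <= n)%N &
  forall t, `|cos (t + c) - p.[t]| <= `|t| ^+ n.
Proof.
elim: n c => [|n IH] c.
  exists 0 => [|t]; first by rewrite size_poly0.
  by rewrite hornerC subr0 expr0 ler_norml cos_geN1 cos_le1.
have [p sp pE] := IH (c + pi / 2).
(* [q] is the antiderivative of [p] with value cos c at 0, so that the error vanishes at 0. *)
pose q := \poly_(i < n.+1) (if i is k.+1 then p`_k / k.+1%:R else cos c).
have q'E : q^`() = p.
  apply/polyP => k; rewrite coef_deriv coef_poly ltnS; case: ltnP => kn; last first.
    by rewrite mul0rn nth_default// (leq_trans sp).
  by rewrite -[LHS]mulr_natr divfK// pnatr_eq0.
have q0 : q.[0] = cos c by rewrite horner_coef0 coef_poly.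
exists q => [|t]; first exact: size_poly.
pose g t := cos (t + c) - q.[t].
pose dg t := cos (t + (c + pi / 2)) - p.[t].
have dgE (x : R) : is_derive x 1 g (dg x).
  rewrite /dg addrA cosDpihalf -q'E.
  apply: is_deriveB; rewrite -[- sin _]mulr1.
  apply: (@is_derive1_comp _ (@cos R) (fun t => t + c)).
  by rewrite -[X in is_derive _ _ _ X]addr0; apply: is_deriveD.
have gc a b : {within `[a, b], continuous g}.
  apply: continuous_subspaceT => x.
  by apply: differentiable_continuous; apply/derivable1_diffP; case: (dgE x).
have g0 : g 0 = 0 by rewrite /g add0r q0 subrr.
rewrite -[cos _ - _]/(g t) -[g t]subr0 -g0.
have [t0|t0] := leP 0 t.
  have [x /itvP xt ->] := @MVT_segment R g dg 0 t t0 (fun x _ => dgE x) (gc 0 t).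
  rewrite subr0 normrM exprSr ler_wpM2r// (le_trans (pE x))// lerXn2r ?nnegrE//.
  by rewrite !ger0_norm// xt.
have [x /itvP xt] := @MVT_segment R g dg t 0 (ltW t0) (fun x _ => dgE x) (gc t 0).
rewrite [`|g t - _|]distrC => ->.
rewrite sub0r normrM normrN exprSr ler_wpM2r// (le_trans (pE x))// lerXn2r ?nnegrE//.
by rewrite (ltr0_norm t0) ler0_norm ?lerN2 xt.
Qed.

End cosine_approximation.

Section moments.
Context (R : realType) (d m : nat).
Implicit Types (nu : {charge set (borelRd R d) -> \bar R}) (b : {ffun 'I_d -> nat}).

(** Like [monomial], but on exponents without a degree bound, since the induction in [mono_dotprodX]
    raises them. *)
Definition mono b (x : 'rV[R]_d) : R := \prod_(i < d) x 0 i ^+ b i.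

Lemma measurable_mono b : measurable_fun (setT : set (borelRd R d)) (mono b).
Proof.
apply: measurable_prod => i _; apply: measurable_funX; exact: measurable_coord.
Qed.

Lemma measurable_enormX k :
  measurable_fun (setT : set (borelRd R d)) (fun x : 'rV[R]_d => enorm x ^+ k).
Proof. by apply: measurable_funX; exact: measurable_enorm. Qed.

Lemma expr_le_1D (a : R) k n : 0 <= a -> (k <= n)%N -> a ^+ k <= 1 + a ^+ n.
Proof.
move=> a0 kn; have [a1|a1] := leP a 1.
  have : a ^+ k <= 1 by exact: exprn_ile1.
  by move=> /le_trans; apply; rewrite lerDl exprn_ge0.
by rewrite (le_trans (ler_weXn2l (ltW a1) kn))// lerDr.
Qed.

Lemma mono_le b x : (\sum_(i < d) b i <= m)%N -> `|mono b x| <= 1 + enorm x ^+ m.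
Proof.
move=> bm; apply: le_trans (expr_le_1D (enorm_ge0 x) bm).
rewrite -prodrXr /mono normr_prod; apply: ler_prod => i _.
by rewrite normr_ge0 normrX lerXn2r ?nnegrE ?enorm_ge0// coord_le_enorm.
Qed.

Definition moment_integrable nu := charge_integrable nu (fun x : 'rV[R]_d => enorm x ^+ m).

Lemma charge_integrable_moment nu (f : 'rV[R]_d -> R) (C : R) :
  moment_integrable nu -> measurable_fun (setT : set (borelRd R d)) f ->
  (forall x, `|f x| <= C * (1 + enorm x ^+ m)) -> charge_integrable nu f.
Proof.
move=> num mf fC; apply: (charge_integrable_le mf fC).
apply: charge_integrableZ; apply: charge_integrableD => //.
by apply: (@charge_integrable_bounded _ _ _ _ _ 1) => // x; rewrite normr1.
Qed.

Variables nu1 nu2 : {charge set (borelRd R d) -> \bar R}.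
Hypotheses (nu1m : moment_integrable nu1) (nu2m : moment_integrable nu2).
Hypothesis nu12 : forall b, (\sum_(i < d) b i <= m)%N ->
  charge_integral nu1 (mono b) = charge_integral nu2 (mono b).

Let agree (f : 'rV[R]_d -> R) := [/\ charge_integrable nu1 f, charge_integrable nu2 f &
  charge_integral nu1 f = charge_integral nu2 f].

Let agree_sum I (r : seq I) (F : I -> 'rV[R]_d -> R) :
  (forall i, agree (F i)) -> agree (fun x => \sum_(i <- r) F i x).
Proof.
move=> aF; split.
- by apply: charge_integrable_sum => i; case: (aF i).
- by apply: charge_integrable_sum => i; case: (aF i).
- rewrite !charge_integral_sum => [|i|i]; [|by case: (aF i)|by case: (aF i)].
  by apply: eq_bigr => i _; case: (aF i).
Qed.

Let agreeZ a f : agree f -> agree (fun x => a * f x).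
Proof.
move=> [i1 i2 E]; split; try exact: charge_integrableZ.
by rewrite !charge_integralZ// E.
Qed.

(** Expanding a single factor x . xi moves one unit of degree from [k] into the exponents [b], which
    avoids the multinomial formula. *)
Lemma mono_dotprodX xi k b : (\sum_(i < d) b i + k <= m)%N ->
  agree (fun x => mono b x * dotprod x xi ^+ k).
Proof.
elim: k b => [|k IH] b bk.
  rewrite addn0 in bk; have -> : (fun x => mono b x * dotprod x xi ^+ 0) = mono b.
    by apply/funext => x; rewrite mulr1.
  by split; [| |exact: nu12]; apply: (@charge_integrable_moment _ _ 1) => //;
    try exact: measurable_mono; move=> x; rewrite mul1r mono_le.
pose b' i : {ffun 'I_d -> nat} := [ffun j => (b j + (j == i))%N].
have -> : (fun x => mono b x * dotprod x xi ^+ k.+1) =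
    (fun x => \sum_(i < d) xi 0 i * (mono (b' i) x * dotprod x xi ^+ k)).
  apply/funext => x; rewrite exprS mulrCA mulr_suml; apply: eq_bigr => i _.
  rewrite mulrA [x 0 i * _]mulrC -!mulrA; congr (_ * _); rewrite mulrA; congr (_ * _).
  rewrite /mono (bigD1 i)//= [RHS](bigD1 i)//= ffunE eqxx addn1 exprS mulrA.
  by congr (_ * _); apply: eq_bigr => j /negbTE ji; rewrite ffunE ji addn0.
apply: agree_sum => i; apply: agreeZ; apply: IH.
rewrite (eq_bigr (fun j => b j + (j == i))%N) => [|j _]; last by rewrite ffunE.
have -> : (\sum_(j < d) (b j + (j == i)) = \sum_(j < d) b j + 1)%N.
  by rewrite big_split/= [X in (_ + X)%N](bigD1 i)//= eqxx [X in (true + X)%N]big1// => j /negbTE->.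
by rewrite addn1 addSnnS.
Qed.

Lemma poly_dotprod_agree (p : {poly R}) xi : (size p <= m.+1)%N ->
  agree (fun x => p.[dotprod x xi]).
Proof.
move=> sp; have -> : (fun x => p.[dotprod x xi]) =
    (fun x => \sum_(i < size p) p`_i * (mono [ffun=> 0%N] x * dotprod x xi ^+ i)).
  apply/funext => x; rewrite horner_coef; apply: eq_bigr => i _.
  by rewrite /mono big1 ?mul1r// => j _; rewrite ffunE.
apply: agree_sum => i; apply: agreeZ; apply: mono_dotprodX.
rewrite big1 => [|j _]; last by rewrite ffunE.
by rewrite -ltnS (leq_trans (ltn_ord i)).
Qed.

(** The polynomial of degree below m that approximates the cosine has the same integral for both
    charges, so only the remainder counts, and it is at most |x . xi|^m. *)
Lemma trig_moment_dist xi c :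
  `|charge_integral nu1 (fun x : borelRd R d => cos (dotprod x xi + c)) -
    charge_integral nu2 (fun x : borelRd R d => cos (dotprod x xi + c))| <=
  (charge_mass nu1 (fun x : borelRd R d => enorm x ^+ m) +
   charge_mass nu2 (fun x : borelRd R d => enorm x ^+ m)) * (d%:R * enorm xi) ^+ m.
Proof.
have [p sp pE] := cos_poly_approx m c.
have [p1 p2 pp] := @poly_dotprod_agree p xi (leqW sp).
set f := fun x => p.[dotprod x xi] in p1 p2 pp.
set h := (fun x : borelRd R d => cos (dotprod x xi + c)).
have ih nu : charge_integrable nu h := trig_charge_integrable nu (trig_cos xi c).
have -> : charge_integral nu1 h - charge_integral nu2 h =
    charge_integral nu1 (fun x => h x - f x) - charge_integral nu2 (fun x => h x - f x).
  rewrite (charge_integralB (ih nu1) p1) (charge_integralB (ih nu2) p2) pp.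
  by move: (charge_integral nu1 h) (charge_integral nu2 h) (charge_integral nu2 f) => u v w; ring.
have bound nu : moment_integrable nu -> charge_integrable nu f ->
    `|charge_integral nu (fun x => h x - f x)| <=
    charge_mass nu (fun x : borelRd R d => enorm x ^+ m) * (d%:R * enorm xi) ^+ m.
  move=> num fi.
  have -> : charge_mass nu (fun x : borelRd R d => enorm x ^+ m) *
      (d%:R * enorm xi) ^+ m =
      charge_mass nu (fun x : borelRd R d => (d%:R * enorm xi) ^+ m * enorm x ^+ m).
    by case: num => n1 n2; rewrite /charge_mass !RintegralZl// -mulrDr mulrC.
  apply: charge_integral_le; last exact: charge_integrableZ.
    have [/integrableP[mf _] _] := charge_integrableB (ih nu) fi.
    by move/measurable_EFinP : mf.
  move=> x; apply: le_trans (pE _) _; rewrite -exprMn lerXn2r ?nnegrE//.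
    by rewrite !mulr_ge0 ?enorm_ge0.
  by rewrite mulrAC; exact: dotprod_le.
apply: le_trans (ler_normB _ _) _; rewrite mulrDl.
by apply: lerD; apply: bound.
Qed.

End moments.

Section moment_class_distance.
Context (R : realType) (d m : nat).
Implicit Types (mu nu : cmeasure (borelRd R d) R) (xi : 'rV[R]_d) (M : multi_index d m -> R[i]).

Lemma finite_momentE mu : finite_moment m mu <->
  cm_integrable mu (fun x : borelRd R d => enorm x ^+ m).
Proof.
apply: cm_integrable_tvar; first exact: measurable_enormX.
by move=> x; rewrite exprn_ge0 ?enorm_ge0.
Qed.

Lemma moment_classE M mu : moment_class M mu <->
  [/\ moment_integrable m (cm_re mu), moment_integrable m (cm_im mu) &
    forall beta : multi_index d m,
      charge_integral (cm_re mu) (mono (val beta)) +i*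
      charge_integral (cm_im mu) (mono (val beta)) = M beta].
Proof.
split=> [[/finite_momentE[? ?] mM]|[? ? mM]].
  by split => // beta; rewrite -mM -cintegral_real.
split=> [|beta]; first exact/finite_momentE.
by rewrite cintegral_real -mM.
Qed.

Lemma moment_class_trig_dist M mu nu : moment_class M mu -> moment_class M nu ->
  exists C, forall xi, Normc.normc (fourier mu xi - fourier nu xi) <= C * enorm xi ^+ m.
Proof.
move=> /moment_classE[mu1 mu2 muM] /moment_classE[nu1 nu2 nuM].
have moments (b : {ffun 'I_d -> nat}) : (\sum_(i < d) b i <= m)%N ->
    charge_integral (cm_re mu) (mono b) = charge_integral (cm_re nu) (mono b) /\
    charge_integral (cm_im mu) (mono b) = charge_integral (cm_im nu) (mono b).
  by move=> bm; have := muM (exist _ b bm); rewrite -nuM => -[].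
have re xi c := trig_moment_dist mu1 nu1 (fun b bm => (moments b bm).1) xi c.
have im xi c := trig_moment_dist mu2 nu2 (fun b bm => (moments b bm).2) xi c.
eexists => xi; apply: le_trans (fourier_dist_le _ _ _) _.
apply: (le_trans (lerD (lerD (re xi _) (im xi _)) (lerD (im xi _) (re xi _)))).
by rewrite exprMn -!mulrDl mulrA.
Qed.

Lemma dm_ubound mu nu xi : xi != 0 ->
  ((Normc.normc (fourier mu xi - fourier nu xi) / enorm xi ^+ m)%:E <= dm m mu nu)%E.
Proof. by move=> xi0; apply: ereal_sup_ubound; exists xi. Qed.

Lemma dm_le mu nu C :
  (forall xi, Normc.normc (fourier mu xi - fourier nu xi) <= C * enorm xi ^+ m) ->
  (dm m mu nu <= C%:E)%E.
Proof.
move=> munuC; apply: ge_ereal_sup => _ [xi xi0 <-]; have {}xi0 : xi != 0 := xi0.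
by rewrite lee_fin ler_pdivrMr ?exprn_gt0 ?enorm_gt0.
Qed.

Hypothesis d_gt0 : (0 < d)%N.

(** A nonzero frequency must exist: in dimension 0 the supremum would run over the empty set and
    equal -oo. *)
Lemma dm_ge0 mu nu : (0 <= dm m mu nu)%E.
Proof.
have x0 : const_mx 1 != 0 :> 'rV[R]_d.
  by apply/eqP => /rowP/(_ (Ordinal d_gt0))/eqP; rewrite !mxE oner_eq0.
apply: le_trans (dm_ubound mu nu x0).
by rewrite lee_fin divr_ge0 ?normc_ge0// exprn_ge0 ?enorm_ge0.
Qed.

Lemma dm_fin M mu nu : moment_class M mu -> moment_class M nu -> dm m mu nu \is a fin_num.
Proof.
move=> muM nuM; have [C munuC] := moment_class_trig_dist muM nuM.
rewrite ge0_fin_numE ?dm_ge0//; apply: le_lt_trans (dm_le munuC) _.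
exact: ltry.
Qed.

Lemma dm_sym mu nu : dm m mu nu = dm m nu mu.
Proof.
suff le_sym mu' nu' : (dm m mu' nu' <= dm m nu' mu')%E.
  by apply/le_anti/andP; split; [exact: (le_sym mu nu)|exact: (le_sym nu mu)].
apply: ge_ereal_sup => _ [xi xi0 <-]; apply: le_trans (dm_ubound nu' mu' xi0).
by rewrite -normcN opprB.
Qed.

Lemma dmxx mu : dm m mu mu = 0%E.
Proof.
apply/eqP; rewrite eq_le dm_ge0 andbT; apply: dm_le => xi.
by rewrite subrr Normc.normc0 mul0r.
Qed.

Lemma dm_triangle mu nu la : (dm m mu la <= dm m mu nu + dm m nu la)%E.
Proof.
apply: ge_ereal_sup => _ [xi xi0 <-]; have {}xi0 : xi != 0 := xi0.
apply: le_trans (leeD (dm_ubound mu nu xi0) (dm_ubound nu la xi0)).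
rewrite -EFinD lee_fin -mulrDl ler_wpM2r ?invr_ge0 ?exprn_ge0 ?enorm_ge0//.
apply: le_trans (le_normcD _ _).
by rewrite addrA subrK.
Qed.

Hypothesis m_gt0 : (0 < m)%N.

Lemma dm_fourier_le M mu nu xi : moment_class M mu -> moment_class M nu ->
  Normc.normc (fourier mu xi - fourier nu xi) <= fine (dm m mu nu) * enorm xi ^+ m.
Proof.
move=> muM nuM; have [->|xi0] := eqVneq xi 0.
  (* The distance ignores xi = 0, but the bound C 0^m vanishes because m > 0, so the transforms
     agree there. *)
  have [C munuC] := moment_class_trig_dist muM nuM; apply: le_trans (munuC 0) _.
  have -> : enorm (0 : 'rV[R]_d) = 0 by rewrite /enorm dotprod0r sqrtr0.
  by rewrite expr0n gtn_eqF// !mulr0.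
rewrite -ler_pdivrMr ?exprn_gt0 ?enorm_gt0// -lee_fin fineK ?(dm_fin muM)//.
exact: dm_ubound.
Qed.

Lemma dm_eq0 M mu nu : moment_class M mu -> moment_class M nu ->
  dm m mu nu = 0%E -> mu = nu.
Proof.
move=> muM nuM munu0; apply: fourier_unique => xi; apply/eqP; rewrite -subr_eq0.
apply/eqP; apply: Normc.eq0_normc; apply/eqP; rewrite eq_le normc_ge0 andbT.
by have := dm_fourier_le xi muM nuM; rewrite munu0 mul0r.
Qed.

End moment_class_distance.

(** * Combinations of Dirac masses and prescribed moments *)

Section adding_diracs.
Context (dsp : measure_display) (T : measurableType dsp) (R : realType).

Section measure_add_finite.
Variables P Q : {finite_measure set T -> \bar R}.

Definition finite_measure_add : set T -> \bar R := measure_add P Q.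

HB.instance Definition _ := Measure.copy finite_measure_add (measure_add P Q).

Let finite_measure_add_fin : fin_num_fun finite_measure_add.
Proof.
by move=> A mA; rewrite /finite_measure_add measure_addE fin_numD !fin_num_measure.
Qed.

HB.instance Definition _ :=
  Measure_isFinite.Build _ _ _ finite_measure_add finite_measure_add_fin.

End measure_add_finite.

Implicit Types (P N : {finite_measure set T -> \bar R}) (nu : {charge set T -> \bar R})
  (mu : cmeasure T R) (f : T -> R).

Lemma measure_add_dirac P (w : R) (a : T) : 0 <= w ->
  exists Q : {finite_measure set T -> \bar R}, forall f, P.-integrable setT (EFin \o f) ->
    Q.-integrable setT (EFin \o f) /\ \int[Q]_x f x = \int[P]_x f x + w * f a.
Proof.
move=> w0; pose D : {finite_measure set T -> \bar R} := mscale (NngNum w0) (dirac a).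
exists (finite_measure_add P D) => f Pf.
have [mf _] := integrableP _ _ _ Pf.
have diracE (g : T -> \bar R) : measurable_fun setT g ->
    (\int[dirac a]_x g x = g a)%E.
  by move=> mg; rewrite integral_dirac// diracT mul1e.
have df : (dirac a : {measure set T -> \bar R}).-integrable setT (EFin \o f).
  apply/integrableP; split => //; rewrite diracE; first exact: ltry.
  exact: measurableT_comp.
have Df : D.-integrable setT (EFin \o f).
  apply/integrableP; split => //; rewrite ge0_integral_mscale//; last exact: measurableT_comp.
  by rewrite diracE ?ltry//; exact: measurableT_comp.
split; first exact: integrable_measure_add.
rewrite Rintegral_measure_add//; congr (_ + _).
(* Scaling of the measure is applied to nonnegative functions, hence the split into positive and
   negative parts. *)
have mp : measurable_fun setT ((EFin \o f)^\+)%E by exact: measurable_funepos.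
have mn : measurable_fun setT ((EFin \o f)^\-)%E by exact: measurable_funeneg.
rewrite /Rintegral integralE !ge0_integral_mscale// !diracE//.
rewrite funeposE funenegE/= -[0%E]/(0%:E) -!EFin_max -!EFinM -EFinB/=.
by rewrite -mulrBr /Num.max; do 2 case: ltP => ? //=; try lra; congr (w * _); lra.
Qed.

(** A measure takes nonnegative weights only, so a mass of negative weight goes into the negative
    part with the opposite sign. *)
Lemma charge_split_dirac nu (w : R) (a : T) :
  exists P N : {finite_measure set T -> \bar R}, forall f, charge_integrable nu f ->
    [/\ P.-integrable setT (EFin \o f), N.-integrable setT (EFin \o f) &
      \int[P]_x f x - \int[N]_x f x = charge_integral nu f + w * f a].
Proof.
have [w0|w0] := leP 0 w.
  have [P PE] := measure_add_dirac (hpos nu) a w0.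
  exists P, (hneg nu) => f [/PE[Pf ->] Nf]; split => //.
  by rewrite /charge_integral addrAC.
have w0' : 0 <= - w by lra.
have [N NE] := measure_add_dirac (hneg nu) a w0'.
exists (hpos nu), N => f [Pf /NE[Nf ->]]; split => //.
by rewrite /charge_integral opprD addrA mulNr opprK.
Qed.

Lemma cm_add_dirac mu (z : R[i]) (a : T) : exists mu' : cmeasure T R,
  forall f, cm_integrable mu f -> [/\ cm_integrable mu' f,
    charge_integral (cm_re mu') f = charge_integral (cm_re mu) f + complex.Re z * f a &
    charge_integral (cm_im mu') f = charge_integral (cm_im mu) f + complex.Im z * f a].
Proof.
have [P1 [N1 PN1]] := charge_split_dirac (cm_re mu) (complex.Re z) a.
have [P2 [N2 PN2]] := charge_split_dirac (cm_im mu) (complex.Im z) a.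
exists (cmeasure_of P1 N1 P2 N2) => f [/PN1[P1f N1f <-] /PN2[P2f N2f <-]].
have [s1 s2] := cm_split_of P1 N1 P2 N2.
have integrable_split nu P N : charge_split nu P N ->
    P.-integrable setT (EFin \o f) -> N.-integrable setT (EFin \o f) -> charge_integrable nu f.
  move=> s Pf Nf; split.
    exact: le_measure_integrable (hpos_le s) Pf.
  exact: le_measure_integrable (hneg_le s) Nf.
split; [|exact: charge_integralE|exact: charge_integralE].
by split; [exact: (integrable_split _ _ _ s1)|exact: (integrable_split _ _ _ s2)].
Qed.

Lemma cm_add_diracs mu (s : seq (R[i] * T)) : exists mu' : cmeasure T R,
  forall f, cm_integrable mu f -> [/\ cm_integrable mu' f,
    charge_integral (cm_re mu') f =
      charge_integral (cm_re mu) f + \sum_(p <- s) complex.Re p.1 * f p.2 &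
    charge_integral (cm_im mu') f =
      charge_integral (cm_im mu) f + \sum_(p <- s) complex.Im p.1 * f p.2].
Proof.
elim: s => [|[z a] s [mu' mu'E]].
  by exists mu => f muf; rewrite !big_nil !addr0.
have [mu'' mu''E] := cm_add_dirac mu' z a.
exists mu'' => f /mu'E[mu'f re im]; have [mu''f re' im'] := mu''E f mu'f.
by rewrite !big_cons/= re' im' re im; split => //; ring.
Qed.

Definition cmeasure0 : cmeasure T R := cmeasure_of mzero mzero mzero mzero.

Lemma cmeasure0E f : measurable_fun setT f -> [/\ cm_integrable cmeasure0 f,
  charge_integral (cm_re cmeasure0) f = 0 & charge_integral (cm_im cmeasure0) f = 0].
Proof.
move=> mf; have [s1 s2] := cm_split_of (@mzero _ T R) (@mzero _ T R) (@mzero _ T R) (@mzero _ T R).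
have i0 : (@mzero _ T R).-integrable setT (EFin \o f).
  by apply/integrableP; split; [exact/measurable_EFinP|rewrite integral_measure_zero].
have integrable_split nu : charge_split nu (@mzero _ T R) (@mzero _ T R) -> charge_integrable nu f.
  move=> s; split.
    exact: le_measure_integrable (hpos_le s) i0.
  exact: le_measure_integrable (hneg_le s) i0.
split; first by split; exact: integrable_split.
  by rewrite (charge_integralE s1 i0 i0) subrr.
by rewrite (charge_integralE s2 i0 i0) subrr.
Qed.

End adding_diracs.

Section interpolation.
Context (R : realType).

(** [L] inverts the transposed Vandermonde matrix of the distinct nodes 1, ..., n. Each row is a
    signed combination of point masses with all but one of its first n moments zero. *)
Lemma interpolation_weights n : exists L : 'M[R]_n, forall k j : 'I_n,
  \sum_(l < n) L k l * l.+1%:R ^+ j = (k == j)%:R.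
Proof.
pose a : 'rV[R]_n := \row_l l.+1%:R.
pose V := (Vandermonde n a)^T.
have uV : V \in unitmx.
  rewrite unitmx_tr unitmxE unitfE det_Vandermonde.
  apply/prodf_neq0 => i _; apply/prodf_neq0 => j ij.
  by rewrite !mxE subr_eq0 eqr_nat eqSS gtn_eqF.
exists (invmx V) => k j.
have := mulVmx uV => /matrixP/(_ k j); rewrite !mxE => <-.
by apply: eq_bigr => l _; rewrite !mxE.
Qed.

End interpolation.

Section prescribed_moments.
Context (R : realType) (d m : nat).

(** Tensor power of the one-dimensional weights: the sum over the grid factors into a product over
    the coordinates. *)
Lemma grid_interpolation : exists L : {ffun 'I_d -> 'I_m.+1} -> {ffun 'I_d -> 'I_m.+1} -> R,
  forall (N : {ffun 'I_d -> 'I_m.+1} -> R) (g : {ffun 'I_d -> 'I_m.+1}),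
  \sum_a (\sum_b N b * L b a) * \prod_(i < d) (a i).+1%:R ^+ g i = N g.
Proof.
have [L LE] := interpolation_weights R m.+1.
exists (fun b a => \prod_(i < d) L (b i) (a i)) => N g.
under eq_bigr => a _ do rewrite mulr_suml.
rewrite exchange_big/= (bigD1 g)//=.
have sumE b : \sum_(a : {ffun 'I_d -> 'I_m.+1})
    N b * \prod_(i < d) L (b i) (a i) * \prod_(i < d) (a i).+1%:R ^+ g i = N b * (b == g)%:R.
  under eq_bigr => a _ do rewrite -mulrA -big_split.
  rewrite -mulr_sumr; congr (_ * _).
  rewrite -(bigA_distr_bigA (fun i (l : 'I_m.+1) => L (b i) l * l.+1%:R ^+ g i)).
  under eq_bigr => i _ do rewrite LE.
  have [->|bg] := eqVneq b g; first by rewrite big1// => i _; rewrite eqxx.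
  have [i bgi] : exists i, b i != g i.
    apply/existsP; rewrite -negb_forall; apply: contra bg => /forallP bg.
    by apply/eqP/ffunP => i; apply/eqP.
  by rewrite (bigD1 i)//= (negbTE bgi) mul0r.
rewrite sumE eqxx mulr1 big1 ?addr0// => b bg.
by rewrite sumE (negbTE bg) mulr0.
Qed.

Lemma moment_class_nonempty (M : multi_index d m -> R[i]) : exists mu, moment_class M mu.
Proof.
have [L LE] := grid_interpolation.
(* Grid exponents have entries at most m but possibly total degree above m; in that case the target
   moment is set to 0. *)
pose Mx (b : {ffun 'I_d -> 'I_m.+1}) : R[i] :=
  if insub [ffun i => b i : nat] is Some beta then M beta else 0.
pose w a := (\sum_b complex.Re (Mx b) * L b a) +i* (\sum_b complex.Im (Mx b) * L b a).
pose pt (a : {ffun 'I_d -> 'I_m.+1}) : borelRd R d := \row_i (a i).+1%:R.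
have [mu muE] := cm_add_diracs (cmeasure0 (borelRd R d) R)
  [seq (w a, pt a) | a <- index_enum {ffun 'I_d -> 'I_m.+1}].
have {}muE f : measurable_fun setT f -> [/\ cm_integrable mu f,
    charge_integral (cm_re mu) f = \sum_a (\sum_b complex.Re (Mx b) * L b a) * f (pt a) &
    charge_integral (cm_im mu) f = \sum_a (\sum_b complex.Im (Mx b) * L b a) * f (pt a)].
  move=> mf; have [i0 re0 im0] := @cmeasure0E _ (borelRd R d) R f mf.
  have [i re im] := muE f i0; rewrite re im re0 im0 !add0r !big_map.
  by split.
exists mu; apply/moment_classE.
have [[mu1 mu2] _ _] := muE _ (@measurable_enormX R d m).
split => // beta; have [_ -> ->] := muE _ (measurable_mono (val beta)).
have betam i : (val beta i < m.+1)%N.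
  by rewrite ltnS (leq_trans _ (valP beta))// (bigD1 i)//= leq_addr.
pose g : {ffun 'I_d -> 'I_m.+1} := [ffun i => Ordinal (betam i)].
have monoE a : mono (val beta) (pt a) = \prod_(i < d) (a i).+1%:R ^+ g i.
  by apply: eq_bigr => i _; rewrite mxE ffunE.
under eq_bigr => a _ do rewrite monoE.
under [X in _ +i* X]eq_bigr => a _ do rewrite monoE.
rewrite (LE (fun b => complex.Re (Mx b))) (LE (fun b => complex.Im (Mx b))).
have -> : Mx g = M beta.
  rewrite /Mx (_ : [ffun i => _] = val beta) ?valK//.
  by apply/ffunP => i; rewrite !ffunE.
by case: (M beta).
Qed.

End prescribed_moments.

(** * Lacunary sums of scaled blocks *)

Section lacunary_series.
Context (R : realType).

(** Dominated convergence for series: the majorant [w] makes the tails small uniformly in k, so the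
    limits in k and n can be exchanged. *)
Lemma tannery (a : nat -> nat -> R) (b w L : nat -> R) (l : R) :
  (forall k j, `|a k j| <= w j) -> cvgn (series w) ->
  (forall j, a k j @[k --> \oo] --> b j) ->
  (forall k, \sum_(j < n) a k j @[n --> \oo] --> L k) ->
  L k @[k --> \oo] --> l ->
  \sum_(j < n) b j @[n --> \oo] --> l.
Proof.
move=> aw cw ab aL Ll.
have w0 j : 0 <= w j by apply: le_trans (aw 0%N j).
have bw j : `|b j| <= w j.
  apply: (@closed_cvg _ _ _ eventually_filter (fun k => `|a k j|) [set y | y <= w j]).
  - exact: closed_le.
  - by apply: nearW => k; exact: aw.
  - by apply: cvg_norm; exact: ab.
set W := limn (series w) in cw.
have tail (c : nat -> R) J n : (forall j, `|c j| <= w j) -> (J <= n)%N ->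
    `|\sum_(j < n) c j - \sum_(j < J) c j| <= W - series w J.
  move=> cle Jn; rewrite -!(big_mkord xpredT c) (big_cat_nat (leq0n J) Jn)//= addrAC subrr add0r.
  apply: le_trans (ler_norm_sum _ _ _) _.
  apply: (@le_trans _ _ (series w n - series w J)).
    rewrite /series/= (big_cat_nat (leq0n J) Jn)//= addrAC subrr add0r.
    by apply: ler_sum.
  rewrite lerD2r; apply: nondecreasing_cvgn_le => //.
  by apply/nondecreasing_seqP => k; rewrite seriesSr lerDl.
apply/cvgrPdist_lt => e e0; have e4 : 0 < e / 4 by rewrite divr_gt0.
have /cvgrPdist_lt/(_ _ e4)[J _ JW] := cw.
have {}JW : W - series w J < e / 4.
  by apply: le_lt_trans (JW J (leqnn J)); rewrite ler_norm.
have aLJ k : `|L k - \sum_(j < J) a k j| <= e / 4.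
  apply: (@closed_cvg _ _ _ eventually_filter
    (fun n => `|\sum_(j < n) a k j - \sum_(j < J) a k j|) [set y | y <= e / 4]).
  - exact: closed_le.
  - near=> n; apply: le_trans (ltW JW); apply: tail => //.
    by near: n; exact: nbhs_infty_ge.
  - by apply: cvg_norm; apply: cvgB; [exact: aL|exact: cvg_cst].
have abJ : \sum_(j < J) a k j @[k --> \oo] --> \sum_(j < J) b j.
  elim: (J) => [|i IH].
    by rewrite big_ord0; under eq_fun do rewrite big_ord0; exact: cvg_cst.
  by rewrite big_ord_recr; under eq_fun do rewrite big_ord_recr; exact: cvgD.
near \oo => k.
have h1 : `|l - L k| < e / 4 by near: k; move/cvgrPdist_lt : Ll; apply.
have h2 : `|\sum_(j < J) b j - \sum_(j < J) a k j| < e / 4.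
  by near: k; move/cvgrPdist_lt : abJ; apply.
near=> n.
have h3 : `|\sum_(j < n) b j - \sum_(j < J) b j| <= e / 4.
  apply: le_trans (ltW JW); apply: tail => //.
  by near: n; exact: nbhs_infty_ge.
have h4 := aLJ k.
(* Four errors of e/4: the limit of [L], the tail of row k, the first J terms, and the tail of
   [b]. *)
have -> : l - \sum_(j < n) b j = (l - L k) + (L k - \sum_(j < J) a k j) -
    (\sum_(j < J) b j - \sum_(j < J) a k j) - (\sum_(j < n) b j - \sum_(j < J) b j) by ring.
apply: le_lt_trans (ler_normB _ _) _.
apply: le_lt_trans (lerD (ler_normB _ _) (lexx _)) _.
apply: le_lt_trans (lerD (lerD (ler_normD _ _) (lexx _)) (lexx _)) _.
lra.
Unshelve. all: by end_near. Qed.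

(** The vanishing moments cancel the polynomial of degree below k that approximates the cosine.
    Adding the constants of the two estimates lets one [C] serve both. *)
Lemma cos_comb_bound n (tau : 'I_n -> R) (t : 'I_n -> R) k :
  (forall j, (j < k)%N -> \sum_l tau l * t l ^+ j = 0) ->
  exists2 C, 0 <= C & forall s c,
    `|\sum_l tau l * cos (t l * s + c)| <= C /\
    `|\sum_l tau l * cos (t l * s + c)| <= C * `|s| ^+ k.
Proof.
move=> tau0; exists (\sum_l `|tau l| + \sum_l `|tau l| * `|t l| ^+ k).
  by apply: addr_ge0; apply: sumr_ge0 => l _; rewrite ?mulr_ge0// exprn_ge0.
move=> s c; split.
  apply: (@le_trans _ _ (\sum_l `|tau l|)); last first.
    by rewrite lerDl sumr_ge0// => l _; rewrite mulr_ge0// exprn_ge0.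
  apply: le_trans (ler_norm_sum _ _ _) _; apply: ler_sum => l _.
  by rewrite normrM ler_piMr// ler_norml cos_geN1 cos_le1.
have [p sp pE] := cos_poly_approx k c.
have p0 : \sum_l tau l * p.[t l * s] = 0.
  under eq_bigr => l _ do rewrite horner_coef mulr_sumr.
  rewrite exchange_big/= big1// => j _.
  rewrite (eq_bigr (fun l => p`_j * s ^+ j * (tau l * t l ^+ j))).
    by rewrite -mulr_sumr tau0 ?mulr0// (leq_trans (ltn_ord j)).
  by move=> l _; rewrite exprMn; ring.
have -> : \sum_l tau l * cos (t l * s + c) = \sum_l tau l * (cos (t l * s + c) - p.[t l * s]).
  rewrite -[LHS]subr0 -[X in _ - X]p0 -sumrB.
  by apply: eq_bigr => l _; rewrite mulrBr.
apply: le_trans (ler_norm_sum _ _ _) _.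
rewrite mulrDl [X in _ <= _ + X]mulr_suml.
apply: (@le_trans _ _ (\sum_l `|tau l| * `|t l| ^+ k * `|s| ^+ k)); last first.
  by rewrite lerDr mulr_ge0 ?exprn_ge0// sumr_ge0.
apply: ler_sum => l _; rewrite normrM -mulrA ler_wpM2l//.
by rewrite -exprMn -normrM.
Qed.

(* The right-hand side telescopes along u, K u, K^2 u, ... *)
Lemma min_inv_le (K u : R) : 2 <= K -> 0 < u ->
  Num.min u u^-1 <= 6 * (K * u / (1 + K * u) - u / (1 + u)).
Proof.
move=> K2 u0; have Ku0 : 0 < K * u by rewrite mulr_gt0//; lra.
have -> : K * u / (1 + K * u) - u / (1 + u) = (K - 1) * u / ((1 + K * u) * (1 + u)).
  by field; apply/andP; split; apply: lt0r_neq0; lra.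
rewrite mulrA ler_pdivlMr; last by apply: mulr_gt0; lra.
have [u1|u1] := leP u 1.
  apply: (@le_trans _ _ (u * ((1 + K * u) * (1 + u)))).
    by rewrite ler_wpM2r ?ge_min ?lexx// mulr_ge0; lra.
  rewrite [leRHS](_ : _ = u * (6 * (K - 1))); last by ring.
  rewrite ler_wpM2l ?(ltW u0)//; have : K * u <= K by rewrite ler_piMr//; lra.
  by nra.
apply: (@le_trans _ _ (u^-1 * ((1 + K * u) * (1 + u)))).
  by rewrite ler_wpM2r ?ge_min ?lexx ?orbT// mulr_ge0; lra.
rewrite mulrC ler_pdivrMr//; nra.
Qed.

Lemma lacunary_sum_le (K s : R) J n : 2 <= K -> 0 < s ->
  \sum_(J <= j < n) Num.min (K ^+ j * s) (K ^+ j * s)^-1 <= 6.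
Proof.
move=> K2 s0; have K0 : 0 < K by lra.
have pos j : 0 < K ^+ j * s by rewrite mulr_gt0// exprn_gt0.
have [nJ|Jn] := leqP n J; first by rewrite big_geq.
(* [phi] is u/(1 + u) at u = K^j s. Each term is at most 6 times an increment of [phi], which stays
   in [0, 1]; hence 6, whatever s, J and n. *)
pose phi j := K ^+ j * s / (1 + K ^+ j * s).
apply: (@le_trans _ _ (\sum_(J <= j < n) 6 * (phi j.+1 - phi j))).
  apply: ler_sum => j _; apply: le_trans (min_inv_le K2 (pos j)) _.
  by rewrite /phi exprS mulrA.
rewrite -mulr_sumr telescope_sumr// ?(ltnW Jn)// ler_piMr//.
have phi0 j : 0 <= phi j by rewrite divr_ge0 ?addr_ge0 ?(ltW (pos j)).
have phi1 j : phi j <= 1.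
  by rewrite ler_pdivrMr ?mul1r ?lerDr// ltr_pwDl// ltW.
by rewrite (le_trans _ (phi1 n))// lerBlDr lerDl.
Qed.

End lacunary_series.

Section lacunary_sequence.
Context (R : realType) (d m : nat).
Hypotheses (d_gt0 : (0 < d)%N) (m_gt0 : (0 < m)%N).
Variable tau : 'I_m.+2 -> R.
Hypothesis tau_moments :
  forall j, (j < m.+1)%N -> \sum_l tau l * l.+1%:R ^+ j = 0.

Let i0 := Ordinal d_gt0.
(** The base exceeds every node 1, ..., m+2, so a point K^j a with a such a node determines j and a,
    like a single digit at position j. It is also at least 2, as the telescoping bound asks. *)
Let K : R := m.+3%:R.

Let K_gt0 : 0 < K. Proof. by rewrite ltr0n. Qed.

Definition lac_coef j : R := j.+1%:R^-1 / K ^+ (j * m).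
Definition lac_pt j (l : 'I_m.+2) : borelRd R d := (K ^+ j * l.+1%:R) *: delta_mx 0 i0.
Definition lac_sum (f : borelRd R d -> R) J n : R :=
  \sum_(J <= j < n) lac_coef j * \sum_l tau l * f (lac_pt j l).

(** With s the first coordinate of xi and u = K^j |s|, block j has modulus |s|^m/(j+1) times
    |T|/u^m, where T is a cosine sum of [tau], and |T|/u^m is at most C min(u, 1/u). The weights
    from J on are at most 1/(J+1), and the minima sum to at most 6. *)
Lemma lac_sum_cos_le : exists2 C, 0 <= C & forall J n xi c,
  `|lac_sum (fun x : borelRd R d => cos (dotprod x xi + c)) J n| <= C / J.+1%:R * enorm xi ^+ m.
Proof.
have [C C0 TC] := @cos_comb_bound R _ tau (fun l => l.+1%:R) m.+1 tau_moments.
exists (6 * C); first by rewrite mulr_ge0.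
move=> J n xi c; set s := xi 0 i0.
have ptE j : \sum_l tau l * cos (dotprod (lac_pt j l) xi + c) =
    \sum_l tau l * cos (l.+1%:R * (K ^+ j * s) + c).
  apply: eq_bigr => l _; congr (_ * cos (_ + _)).
  by rewrite dotprodC dotprodZr dotprod_delta -/s; ring.
rewrite /lac_sum; under eq_bigr => j _ do rewrite ptE.
have [s0|s0] := eqVneq s 0.
  rewrite big1 ?normr0 => [|j _].
    by rewrite mulr_ge0 ?exprn_ge0 ?enorm_ge0// divr_ge0// mulr_ge0.
  have [_] := TC (K ^+ j * s) c; rewrite s0 mulr0 normr0 expr0n/= mulr0 normr_le0.
  by move=> /eqP ->; rewrite mulr0.
have s_gt0 : 0 < `|s| by rewrite normr_gt0.
apply: (@le_trans _ _ (6 * C / J.+1%:R * `|s| ^+ m)); last first.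
  rewrite ler_wpM2l ?divr_ge0 ?mulr_ge0// lerXn2r ?nnegrE ?enorm_ge0//.
  exact: coord_le_enorm.
apply: le_trans (ler_norm_sum _ _ _) _.
have K2 : 2 <= K by rewrite ler_nat.
apply: (@le_trans _ _ (\sum_(J <= j < n)
    (C / J.+1%:R * `|s| ^+ m) * Num.min (K ^+ j * `|s|) (K ^+ j * `|s|)^-1)); last first.
  rewrite -mulr_sumr [leRHS](_ : _ = C / J.+1%:R * `|s| ^+ m * 6); last by ring.
  rewrite ler_wpM2l ?lacunary_sum_le//.
  by rewrite mulr_ge0 ?exprn_ge0// divr_ge0.
rewrite big_nat [leRHS]big_nat; apply: ler_sum => j /andP[Jj _].
have [] := TC (K ^+ j * s) c; set T := \sum_l _; move=> T1 T2.
set u := K ^+ j * `|s|; have u_gt0 : 0 < u by rewrite mulr_gt0// exprn_gt0.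
have uE : `|K ^+ j * s| = u by rewrite normrM ger0_norm// exprn_ge0// ltW.
rewrite uE in T2.
have Kjm : K ^+ (j * m) = u ^+ m / `|s| ^+ m.
  by rewrite /u exprMn -exprM mulfK// expf_neq0// gt_eqF.
rewrite normrM ger0_norm; last by rewrite divr_ge0// exprn_ge0// ltW.
rewrite /lac_coef Kjm invf_div.
have Tu : `|T| / u ^+ m <= C * Num.min u u^-1.
  (* Low frequencies: vanishing of the moments of orders 0 to m leaves one factor u after division
     by u^m. *)
  have h1 : `|T| / u ^+ m <= C * u.
    by rewrite ler_pdivrMr ?exprn_gt0// -mulrA -exprS.
  have h2 : `|T| / u ^+ m <= C / u.
    have [u1|u1] := leP u 1.
      apply: (le_trans h1); rewrite ler_wpM2l// -[leRHS]mul1r ler_pdivlMr//.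
      by rewrite -expr2 expr_le1// ltW.
    (* High frequencies: boundedness of the cosine sum and m > 0 leave at least one factor 1/u. *)
    rewrite ler_pdivrMr ?exprn_gt0// -mulrA; apply: (le_trans T1).
    rewrite ler_peMr// -(prednK m_gt0) exprS mulKf ?gt_eqF//.
    by rewrite exprn_ege1// ltW.
  by rewrite /Num.min; case: ifP.
rewrite [leLHS](_ : _ = (j.+1%:R^-1 * `|s| ^+ m) * (`|T| / u ^+ m)); last by ring.
rewrite [leRHS](_ : _ = (J.+1%:R^-1 * `|s| ^+ m) * (C * Num.min u u^-1)); last by ring.
apply: ler_pM => //.
- by rewrite divr_ge0 ?exprn_ge0// ltW.
- by rewrite ler_wpM2r ?exprn_ge0// lef_pV2 ?posrE// ler_nat.
Qed.

Lemma mono_scale (b : {ffun 'I_d -> nat}) a (v : 'rV[R]_d) :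
  mono b (a *: v) = a ^+ (\sum_(i < d) b i) * mono b v.
Proof.
rewrite -prodrXr /mono -big_split; apply: eq_bigr => i _.
by rewrite mxE exprMn.
Qed.

(** On a line through 0 a monomial of degree k is a multiple of t^k, which [tau] annihilates for k
    at most m; so adding blocks preserves the moment class. *)
Lemma lac_sum_mono (b : {ffun 'I_d -> nat}) J n :
  (\sum_(i < d) b i <= m)%N -> lac_sum (mono b) J n = 0.
Proof.
move=> bm; rewrite /lac_sum big1// => j _; set k := (\sum_(i < d) b i)%N in bm.
rewrite (eq_bigr (fun l : 'I_m.+2 =>
    K ^+ (j * k) * mono b (delta_mx 0 i0) * (tau l * l.+1%:R ^+ k))).
  by rewrite -mulr_sumr tau_moments// !mulr0.
by move=> l _; rewrite /lac_pt mono_scale -/k exprMn -exprM; ring.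
Qed.

Lemma lac_sequence (M : multi_index d m -> R[i]) mu0 : moment_class M mu0 ->
  exists u : nat -> cmeasure (borelRd R d) R, forall n, moment_class M (u n) /\
    forall f, cm_integrable mu0 f ->
      charge_integral (cm_re (u n)) f = charge_integral (cm_re mu0) f + lac_sum f 0 n /\
      charge_integral (cm_im (u n)) f = charge_integral (cm_im mu0) f.
Proof.
move=> mu0M.
suff /choice[u uE] : forall n, exists mu : cmeasure (borelRd R d) R, moment_class M mu /\
    forall f, cm_integrable mu0 f ->
      charge_integral (cm_re mu) f = charge_integral (cm_re mu0) f + lac_sum f 0 n /\
      charge_integral (cm_im mu) f = charge_integral (cm_im mu0) f by exists u.
move=> n; have [mu muE] := cm_add_diracs mu0
  [seq ((lac_coef j * tau l)%:C, lac_pt j l) | j <- index_iota 0 n, l <- index_enum 'I_m.+2].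
have {}muE f : cm_integrable mu0 f -> [/\ cm_integrable mu f,
    charge_integral (cm_re mu) f = charge_integral (cm_re mu0) f + lac_sum f 0 n &
    charge_integral (cm_im mu) f = charge_integral (cm_im mu0) f].
  move=> /muE[i -> ->]; split => //; rewrite big_allpairs_dep/=.
    congr (_ + _); apply: eq_bigr => j _; rewrite mulr_sumr.
    by apply: eq_bigr => l _; rewrite mulrA.
  by rewrite big1 ?addr0// => j _; rewrite big1// => l _; rewrite mul0r.
exists mu; split; last by move=> f /muE[].
have /moment_classE[m1 m2 mM] := mu0M.
have [[m1' m2'] _ _] := muE _ (conj m1 m2).
apply/moment_classE; split => // beta.
have ib (nu : {charge set (borelRd R d) -> \bar R}) :
    moment_integrable m nu -> charge_integrable nu (mono (val beta)).
  move=> im; apply: (@charge_integrable_moment _ _ m _ _ 1) => //.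
    exact: measurable_mono.
  by move=> x; rewrite mul1r mono_le// (valP beta).
have [_ -> ->] := muE _ (conj (ib _ m1) (ib _ m2)).
by rewrite lac_sum_mono ?addr0 ?(valP beta).
Qed.

Lemma trig_cm_integrable (mu : cmeasure (borelRd R d) R) (f : 'rV[R]_d -> R) :
  trig_closure f -> cm_integrable mu f.
Proof. by move=> tf; split; exact: trig_charge_integrable. Qed.

(** Since m > 0, the masses decay geometrically even though the moments of order m decay only
    harmonically; this is the majorant for [tannery]. *)
Lemma lac_coef_bound j : 0 <= lac_coef j <= K^-1 ^+ j.
Proof.
have K1 : 1 <= K by rewrite ler1n.
rewrite /lac_coef divr_ge0 ?exprn_ge0 ?(ltW K_gt0)//=.
apply: (@le_trans _ _ (K ^+ (j * m))^-1).
  by rewrite ler_piMl ?invr_ge0 ?exprn_ge0 ?(ltW K_gt0)// invf_le1 ?ler1n.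
rewrite exprVn lef_pV2 ?posrE ?exprn_gt0//.
by rewrite ler_weXn2l// leq_pmulr.
Qed.

(* The limit identity passes to bounded pointwise limits because the masses of
   the lacunary blocks are summable. *)
Lemma lac_sum_trig_cvg (nu1 nu2 : {charge set (borelRd R d) -> \bar R}) :
  (forall xi c, lac_sum (fun x : borelRd R d => cos (dotprod x xi + c)) 0 n @[n --> \oo] -->
     charge_integral nu1 (fun x : borelRd R d => cos (dotprod x xi + c)) -
     charge_integral nu2 (fun x : borelRd R d => cos (dotprod x xi + c))) ->
  forall f : 'rV[R]_d -> R, trig_closure f ->
    lac_sum f 0 n @[n --> \oo] --> charge_integral nu1 f - charge_integral nu2 f.
Proof.
move=> lac_cos f; elim=> [xi c|f1 f2 tf1 IH1 tf2 IH2|a f1 tf1 IH1|C F g tF IHF FC Fg].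
- exact: lac_cos.
- rewrite !charge_integralD; do ?exact: trig_charge_integrable.
  rewrite (_ : (fun n => _) = (fun n => lac_sum f1 0 n + lac_sum f2 0 n)).
    rewrite opprD addrACA; exact: cvgD.
  apply/funext => n; rewrite /lac_sum -big_split; apply: eq_bigr => j _ /=.
  by rewrite -mulrDr -big_split; congr (_ * _); apply: eq_bigr => l _; rewrite mulrDr.
- rewrite !charge_integralZ; do ?exact: trig_charge_integrable.
  rewrite (_ : (fun n => _) = (fun n => a * lac_sum f1 0 n)).
    by rewrite -mulrBr; apply: cvgMr.
  apply/funext => n; rewrite /lac_sum mulr_sumr; apply: eq_bigr => j _ /=.
  rewrite mulrCA; congr (_ * _); rewrite mulr_sumr.
  by apply: eq_bigr => l _; rewrite mulrCA.
- have mg := trig_measurable (trig_lim tF FC Fg).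
  have mF n := trig_measurable (tF n).
  pose b h j := lac_coef j * \sum_l tau l * h (lac_pt j l).
  have lacE h : (fun n => lac_sum h 0 n) = (fun n => \sum_(j < n) b h j).
    by apply/funext => n; rewrite /lac_sum big_mkord.
  rewrite lacE; apply: (@tannery _ (fun k => b (F k)) (b g)
    (geometric (C * \sum_l `|tau l|) K^-1)
    (fun k => charge_integral nu1 (F k) - charge_integral nu2 (F k))).
  + move=> k j; rewrite /b normrM/= mulrC; have /andP[c0 cK] := lac_coef_bound j.
    apply: ler_pM => //; last by rewrite ger0_norm.
    apply: le_trans (ler_norm_sum _ _ _) _; rewrite mulr_sumr.
    by apply: ler_sum => l _; rewrite normrM mulrC ler_wpM2r.
  + apply: is_cvg_geometric_series; rewrite ger0_norm ?invr_ge0 ?(ltW K_gt0)//.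
    by rewrite invf_lt1// ltr1n.
  + move=> j; apply: cvgMr; apply: cvg_big => // [|l _]; first exact: add_continuous.
    by apply: cvgMr; exact: Fg.
  + by move=> k; rewrite -lacE; exact: IHF.
  + by apply: cvgB; exact: (charge_integral_bounded_cvg mF mg FC Fg).
Qed.

Let pow_digit_inj (j j' a b : nat) : (0 < a < m.+3)%N -> (0 < b < m.+3)%N ->
  K ^+ j * a%:R = K ^+ j' * b%:R -> j = j' /\ a = b.
Proof.
move=> aK bK; rewrite -!natrX -!natrM => /eqP; rewrite eqr_nat => /eqP.
have lt_absurd i i' (e f : nat) : (0 < e < m.+3)%N -> (0 < f < m.+3)%N ->
    (i < i')%N -> (m.+3 ^ i * e)%N <> (m.+3 ^ i' * f)%N.
  move=> /andP[e0 eK] /andP[f0 _] ii'.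
  (* After cancelling the smaller power, e is a positive multiple of m+3, against e < m+3. *)
  rewrite -(subnKC ii') expnD expnS -mulnA [(m.+3 * _)%N]mulnC -!mulnA => /eqP.
  rewrite eqn_pmul2l ?expn_gt0// => /eqP eE; move: eK; rewrite eE ltnNge => /negP; apply.
  by rewrite leq_pmulr// muln_gt0 expn_gt0.
have [jj'|jj'|->] := ltngtP j j'.
- by move=> /(lt_absurd _ _ _ _ aK bK jj').
- by move=> /esym/(lt_absurd _ _ _ _ bK aK jj').
- by move=> /eqP; rewrite eqn_pmul2l ?expn_gt0// => /eqP.
Qed.

Let ord_digit (l : 'I_m.+2) : (0 < l.+1 < m.+3)%N.
Proof. by rewrite /= ltnS ltn_ord. Qed.

Variable l0 : 'I_m.+2.

Let height j : R := K ^+ j * l0.+1%:R.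

Let height_inj j j' : height j = height j' -> j = j'.
Proof. by move=> E; have [] := pow_digit_inj (ord_digit l0) (ord_digit l0) E. Qed.

(** A discontinuous stand-in for |x|^m: it has the size of an m-th power but sees a single atom,
    that of node [l0], in each of the first J blocks, so that the signs of [tau] cannot cancel. *)
Definition spikes J (x : 'rV[R]_d) : R :=
  \sum_(j < J) height j ^+ m * \1_[set y : 'rV[R]_d | y 0 i0 = height j] x.

Lemma trig_spikes J : trig_closure (spikes J).
Proof.
elim: J => [|J IH].
  by apply: (trig_eq (trig_cst d 0)) => x; rewrite /spikes big_ord0.
apply: (trig_eq (trig_add IH (trig_scale (height J ^+ m) (trig_eq_coord i0 (height J))))) => x.
by rewrite /spikes big_ord_recr.
Qed.

Lemma spikesE J (x : 'rV[R]_d) j : (j < J)%N -> x 0 i0 = height j -> spikes J x = height j ^+ m.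
Proof.
move=> jJ xj; rewrite /spikes (bigD1 (Ordinal jJ))//= indicE mem_set// mulr1.
rewrite big1 ?addr0// => k kj; rewrite indicE memNset ?mulr0//= => xk.
by move: kj; rewrite -val_eqE/= => /eqP; apply; apply: height_inj; rewrite -xk.
Qed.

Lemma spikes_eq0 J (x : 'rV[R]_d) : (forall j, (j < J)%N -> x 0 i0 != height j) -> spikes J x = 0.
Proof.
move=> xj; rewrite /spikes big1// => j _; rewrite indicE memNset ?mulr0//=.
by apply/eqP; exact: xj.
Qed.

Lemma spikes_le J x : `|spikes J x| <= enorm x ^+ m.
Proof.
have [[j jJ xj]|nj] := pselect (exists2 j, (j < J)%N & x 0 i0 = height j).
  rewrite (spikesE jJ xj) normrX lerXn2r ?nnegrE ?enorm_ge0//.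
  by rewrite -xj coord_le_enorm.
rewrite spikes_eq0 ?normr0 ?exprn_ge0 ?enorm_ge0// => j jJ.
by apply/eqP => xj; apply: nj; exists j.
Qed.

(** The power K^(jm) in the spike cancels the one in [lac_coef] and leaves the harmonic weight; by
    uniqueness of digits all other atoms lie off the spikes. *)
Lemma lac_sum_spikes J n : (J <= n)%N ->
  lac_sum (spikes J) 0 n = tau l0 * l0.+1%:R ^+ m * \sum_(j < J) j.+1%:R^-1.
Proof.
move=> Jn; have ptE j l : lac_pt j l 0 i0 = K ^+ j * l.+1%:R.
  by rewrite /lac_pt mxE mxE !eqxx mulr1.
rewrite /lac_sum (big_cat_nat (leq0n J) Jn)/= [X in _ + X]big_nat [X in _ + X]big1 ?addr0.
  rewrite big_mkord mulr_sumr; apply: eq_bigr => j _.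
  rewrite (bigD1 l0)//= big1 ?addr0 => [|l ll0].
    rewrite (spikesE (ltn_ord j) (ptE _ _)) /height exprMn -exprM /lac_coef.
    by field; rewrite expf_neq0 ?gt_eqF// pnatr_eq0.
  rewrite spikes_eq0 ?mulr0// => k _; rewrite ptE; apply: contra ll0 => /eqP.
  move=> E; have [_ [ll0]] := pow_digit_inj (ord_digit l) (ord_digit l0) E.
  by apply/eqP/val_inj.
move=> j /andP[Jj _]; rewrite big1 ?mulr0// => l _.
rewrite spikes_eq0 ?mulr0// => k kJ; rewrite ptE; apply/eqP => E.
have [jk _] := pow_digit_inj (ord_digit l) (ord_digit l0) E.
by move: Jj; rewrite jk leqNgt kJ.
Qed.

Hypothesis tau_l0 : tau l0 != 0.

(** Finite moments bound the pairings with [spikes J] by one constant for all J, while the limit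
    identity makes their difference a fixed nonzero multiple of a harmonic partial sum. *)
Lemma lac_sum_not_moment_integrable (nu1 nu2 : {charge set (borelRd R d) -> \bar R}) :
  moment_integrable m nu1 -> moment_integrable m nu2 ->
  ~ (forall xi c, lac_sum (fun x : borelRd R d => cos (dotprod x xi + c)) 0 n @[n --> \oo] -->
     charge_integral nu1 (fun x : borelRd R d => cos (dotprod x xi + c)) -
     charge_integral nu2 (fun x : borelRd R d => cos (dotprod x xi + c))).
Proof.
move=> nu1m nu2m lac_cos; apply: (@dvg_harmonic R).
set B := charge_mass nu1 (fun x : borelRd R d => enorm x ^+ m) +
  charge_mass nu2 (fun x : borelRd R d => enorm x ^+ m).
have D0 : 0 < `|tau l0 * l0.+1%:R ^+ m|.
  by rewrite normr_gt0 mulf_neq0// expf_neq0// pnatr_eq0.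
apply: nondecreasing_is_cvgn.
  by apply/nondecreasing_seqP => k; rewrite seriesSr lerDl/= invr_ge0.
exists (B / `|tau l0 * l0.+1%:R ^+ m|) => _ [J _ <-].
have mS := trig_measurable (trig_spikes J).
have SE : charge_integral nu1 (spikes J) - charge_integral nu2 (spikes J) =
    tau l0 * l0.+1%:R ^+ m * \sum_(j < J) j.+1%:R^-1.
  have lim1 := lac_sum_trig_cvg lac_cos (trig_spikes J).
  have lim2 : lac_sum (spikes J) 0 n @[n --> \oo] -->
      tau l0 * l0.+1%:R ^+ m * \sum_(j < J) j.+1%:R^-1.
    apply: cvg_near_cst; near=> n; apply: lac_sum_spikes.
    by near: n; exact: nbhs_infty_ge.
  exact: (cvg_unique _ lim1 lim2).
rewrite ler_pdivlMr// /series/= big_mkord mulrC -[X in _ * X]ger0_norm; last first.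
  by apply: sumr_ge0 => j _; rewrite invr_ge0.
rewrite -normrM -SE; apply: le_trans (ler_normB _ _) _.
by apply: lerD; apply: charge_integral_le => // x; exact: spikes_le.
Unshelve. all: by end_near. Qed.

End lacunary_sequence.

(** * The metric space and its incompleteness *)

Section moment_metric.
Context (R : realType) (d m : nat) (M : multi_index d m -> R[i]).

(** The positivity proofs are arguments of this alias so that the metric instance declared on it can
    use them. *)
Definition moment_space & (0 < d)%N & (0 < m)%N : Type := moment_class M.

Variables (d_gt0 : (0 < d)%N) (m_gt0 : (0 < m)%N).

Let X := moment_space d_gt0 m_gt0.

HB.instance Definition _ := gen_eqMixin X.
HB.instance Definition _ := gen_choiceMixin X.

Definition moment_dist (mu nu : X) : R := fine (dm m (val mu) (val nu)).

Let memX (mu : X) : moment_class M (val mu).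
Proof. by have := valP mu; rewrite inE. Qed.

Lemma moment_distE (mu nu : X) : (moment_dist mu nu)%:E = dm m (val mu) (val nu).
Proof. by rewrite fineK// (dm_fin d_gt0 (memX mu)). Qed.

Let distxx mu : moment_dist mu mu = 0.
Proof. by rewrite /moment_dist dmxx. Qed.

Let dist_positivity mu nu : moment_dist mu nu = 0 -> mu = nu.
Proof.
move=> munu0; apply: val_inj; apply: (dm_eq0 d_gt0 m_gt0 (memX mu) (memX nu)).
by rewrite -moment_distE munu0.
Qed.

Let dist_sym mu nu : moment_dist mu nu = moment_dist nu mu.
Proof. by rewrite /moment_dist dm_sym. Qed.

Let dist_triangle nu mu la : moment_dist mu la <= moment_dist mu nu + moment_dist nu la.
Proof.
have real_le (a b c : R) (A B C : \bar R) : a%:E = A -> b%:E = B -> c%:E = C ->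
    (A <= B + C)%E -> a <= b + c by move=> <- <- <-; rewrite -EFinD lee_fin.
apply: (real_le _ _ _ _ _ _ (moment_distE mu la) (moment_distE mu nu) (moment_distE nu la)).
exact: dm_triangle.
Qed.

HB.instance Definition _ := isMetric.Build R X distxx dist_positivity dist_sym dist_triangle.

End moment_metric.

Section incompleteness.
Context (R : realType) (d m : nat) (M : multi_index d m -> R[i]).
Hypotheses (d_gt0 : (0 < d)%N) (m_gt0 : (0 < m)%N).

Lemma moment_cauchy_no_limit : exists2 u : nat -> cmeasure (borelRd R d) R,
  (forall n, moment_class M (u n)) /\
  (exists C, forall J n, (J <= n)%N -> (dm m (u J) (u n) <= (C / J.+1%:R)%:E)%E) &
  forall nu, moment_class M nu -> ~ (fine (dm m nu (u n)) @[n --> \oo] --> 0).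
Proof.
have [mu0 mu0M] := moment_class_nonempty M.
have [L LE] := interpolation_weights R m.+2.
(* The last row: among the moments of orders 0, ..., m+1 only the one of order m+1 is nonzero. So
   the orders up to m vanish although [tau] does not. *)
pose tau := L ord_max.
have tau_moments j : (j < m.+1)%N -> \sum_l tau l * l.+1%:R ^+ j = 0.
  move=> jm; have jm2 : (j < m.+2)%N by exact: ltnW.
  by have := LE ord_max (Ordinal jm2); rewrite -val_eqE/= gtn_eqF.
have [l0 tau_l0] : exists l0, tau l0 != 0.
  apply/existsP; rewrite -negb_forall; apply/negP => /forallP tau0.
  have := LE ord_max ord_max; rewrite eqxx big1 => [/eqP|l _].
    by rewrite eq_sym oner_eq0.
  by rewrite -/(tau l) (eqP (tau0 l)) mul0r.
have [u uE] := lac_sequence d_gt0 tau_moments mu0M.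
have [C C0 lacC] := lac_sum_cos_le d_gt0 m_gt0 tau_moments.
have cosI xi c := trig_cm_integrable mu0 (trig_cos xi c).
have re_u n xi c : re_cos (u n) xi c = re_cos mu0 xi c +
    lac_sum d_gt0 tau (fun x : borelRd R d => cos (dotprod x xi + c)) 0 n.
  by have [_ /(_ _ (cosI xi c))[]] := uE n.
have im_u n xi c : im_cos (u n) xi c = im_cos mu0 xi c.
  by have [_ /(_ _ (cosI xi c))[]] := uE n.
exists u; first split.
- by move=> n; case: (uE n).
- exists (C + C) => J n Jn; apply: dm_le => xi.
  have re_dist c : `|re_cos (u J) xi c - re_cos (u n) xi c| <= C / J.+1%:R * enorm xi ^+ m.
    rewrite !re_u opprD addrACA subrr add0r distrC.
    rewrite {1}/lac_sum (big_cat_nat (leq0n J) Jn)/= addrAC subrr add0r.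
    exact: lacC.
  apply: le_trans (fourier_dist_le _ _ _) _.
  have im_dist c : `|im_cos (u J) xi c - im_cos (u n) xi c| = 0.
    by rewrite !im_u subrr normr0.
  rewrite (im_dist 0) (im_dist (- (pi / 2))); move: (re_dist 0) (re_dist (- (pi / 2))).
  move: `|re_cos (u J) xi 0 - _| `|re_cos (u J) xi (- (pi / 2)) - _| => a b ha hb.
  by rewrite addr0 add0r (le_trans (lerD ha hb))// -mulrDl -mulrDl.
- move=> nu nuM nu0.
  have /moment_classE[nu_re _ _] := nuM.
  have /moment_classE[mu0_re _ _] := mu0M.
  (* If [nu] were the limit, the lacunary sums would converge to the cosine integrals of Re nu - Re
     mu0, a difference of charges with finite moments. *)
  apply: (lac_sum_not_moment_integrable m_gt0 tau_l0 nu_re mu0_re) => xi c.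
  rewrite -/(re_cos nu xi c) -/(re_cos mu0 xi c).
  rewrite (_ : (fun n => _) = (fun n => re_cos (u n) xi c - re_cos mu0 xi c)); last first.
    by apply/funext => n; rewrite re_u addrAC subrr add0r.
  apply: cvgB; last exact: cvg_cst.
  (* Convergence in [dm] gives convergence of the transforms at the fixed frequencies xi and -xi,
     hence of the cosine integrals. *)
  have bound n : `|re_cos nu xi c - re_cos (u n) xi c| <=
      fine (dm m nu (u n)) * (enorm xi ^+ m + enorm (- xi) ^+ m).
    have [un _] := uE n; apply: le_trans (re_cos_dist_le _ _ _ _) _; rewrite mulrDr.
    by apply: lerD; exact: (dm_fourier_le d_gt0 m_gt0 _ nuM un).
  have lim0 : fine (dm m nu (u n)) * (enorm xi ^+ m + enorm (- xi) ^+ m) @[n --> \oo] --> 0.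
    by rewrite -[X in _ --> X](mul0r (enorm xi ^+ m + enorm (- xi) ^+ m)); exact: cvgMl.
  apply/cvgrPdist_lt => e e0; have /cvgrPdist_lt/(_ _ e0) := lim0.
  apply: filterS => n; rewrite sub0r normrN; apply: le_lt_trans.
  exact: le_trans (bound n) (ler_norm _).
Qed.

End incompleteness.

Theorem theorem1 (R : realType) (d m : nat) (M : multi_index d m -> R[i]) :
  (1 <= d)%N -> (2 <= m)%N ->
  exists c : Metric.axioms_ R (moment_class M),
    let X : metricType R := Metric.Pack c in
    (forall mu nu : moment_class M,
       dm m (val mu) (val nu) = (mdist (mu : X) (nu : X))%:E) /\
    ~ complete_metric X.
Proof.
move=> d_gt0 m_ge2; have m_gt0 : (0 < m)%N by exact: ltnW.
(* The metric is declared on [moment_space], which unfolds to [moment_class M], so its class is a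
   witness. *)
exists (Metric.class (moment_space M d_gt0 m_gt0)) => X.
have distE (mu nu : X) : mdist mu nu = fine (dm m (val mu) (val nu)) by [].
split=> [mu nu|complete].
  exact: esym (@moment_distE R d m M d_gt0 m_gt0 mu nu).
have [u [uM [C uC]] u_no_limit] := moment_cauchy_no_limit M d_gt0 m_gt0.
pose v n : X := exist _ (u n) (mem_set (uM n)).
have v_cauchy : cauchy (v @ \oo).
  (* It suffices to enclose a tail in a ball of radius e; the centre is [v J] for a J with |C|/(J+1)
     < e. *)
  apply: cauchy_exP => e e0.
  have : (fun n => C / n.+1%:R) @ \oo --> (0 : R).
    by rewrite -[X in _ --> X](mulr0 C); apply: cvgMr; exact: cvg_harmonic.
  move=> /cvgrPdist_lt/(_ _ e0)[J _ JC].
  exists (v J); exists J => // n /= Jn; rewrite ballEmdist/= distE.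
  apply: le_lt_trans (JC J (leqnn J)); rewrite sub0r normrN.
  apply: le_trans (ler_norm _); rewrite -lee_fin fineK; first exact: uC.
  exact: (dm_fin d_gt0 (uM J) (uM n)).
have [l vl] := complete v v_cauchy.
have lM : moment_class M (val l) by have := valP l; rewrite inE.
apply: (u_no_limit _ lM); apply/cvgrPdist_lt => e e0.
have /vl : nbhs l (ball l e) by exact: nbhsx_ballx.
case=> N _ vN; exists N => // n /vN; rewrite /= ballEmdist/= distE sub0r normrN.
by rewrite ger0_norm// fine_ge0// dm_ge0.
Qed.
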